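(* For any $x\in\mathbb{R}_+^2$ with $x(1)+x(2)<1$ and $x(1)>0$, there exist $C_7>0$ and $N>0$ such that, with $x_n=\lfloor xn\rfloor$, $$\frac{|P_{x_n}(\tau_n<\tau_0)-P_{T_n(x_n)}(\tau<\infty)|}{P_{x_n}(\tau_n<\tau_0)}=\frac{|P_{x_n}(\tau_n<\tau_0)-P_{x_n}(\bar\tau_n<\infty)|}{P_{x_n}(\tau_n<\tau_0)}<e^{-C_7 n}$$ for all $n>N$.
   Context: Parameters: $\lambda_1,\lambda_2,\mu_1,\mu_2>0$ with $\lambda_1+\lambda_2+\mu_1+\mu_2=1$; $\rho_i=\lambda_i/\mu_i$, $r=(\lambda_1+\lambda_2)/(\mu_1+\mu_2)$. Standing assumptions: $\rho_1,\rho_2<1$, $\rho_2\le r\le\rho_1$, $\rho_1\ne\rho_2$, $r^2/\rho_2<1$. $I_1,I_2,\dots$ are i.i.d. with $P(I_k=(1,0))=\lambda_1$, $P(I_k=(0,1))=\lambda_2$, $P(I_k=(-1,0))=\mu_1$, $P(I_k=(0,-1))=\mu_2$. $X$ is the constrained random walk on $\mathbb{Z}_+^2$: at each step $X$ moves by the next increment $v$ if this keeps it in $\mathbb{Z}_+^2$, and otherwise does not move. $\tau_n=\inf\{k\ge0: X_k(1)+X_k(2)=n\}$; so $\tau_0$ is the hitting time of the origin. $Y$ is the walk on $\mathbb{Z}\times\mathbb{Z}_+$ with i.i.d. increments $J_k=(-I_k(1),I_k(2))$: it moves by the next increment if this keeps it in $\mathbb{Z}\times\mathbb{Z}_+$,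 and otherwise does not move. $\tau=\inf\{k\ge 0: Y_k(1)=Y_k(2)\}$. $T_n(x)=(n-x(1),x(2))$. $\bar X_k=T_n(Y_k)$, i.e. $\bar X$ is the walk on $\mathbb{Z}\times\mathbb{Z}_+$ with increments $I_k$, constrained only to keep the second coordinate nonnegative (a step leaving $\mathbb{Z}\times\mathbb{Z}_+$ is suppressed), and $\bar\tau_n=\inf\{k\ge 0:\bar X_k(1)+\bar X_k(2)=n\}$. $P_x$ (resp. $P_y$) denotes the law of the relevant walk started from $x$ (resp. $y$). $\lfloor\cdot\rfloor$ acts componentwise. *)

(* Defs.v *)
From HB Require Import structures.
From mathcomp Require Import all_boot all_order all_algebra.
From mathcomp Require Import all_classical all_reals all_analysis.

Set Implicit Arguments.
Unset Strict Implicit.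
Unset Printing Implicit Defensive.

Import Order.TTheory GRing.Theory Num.Theory.

Local Open Scope classical_set_scope.
Local Open Scope ring_scope.

Section Iid.
Context d (T : measurableType d) (R : realType) (P : probability T R).

(* Random elements of E, where E (countable in the application) carries the
   discrete sigma-algebra of all its subsets. *)
Definition discrete_random (E : Type) (X : T -> E) : Prop :=
  forall A : set E, measurable (X @^-1` A).

Definition mutually_independent (E : Type) (X : nat -> T -> E) : Prop :=
  forall (s : seq nat) (A : nat -> set E), uniq s ->
    P (\bigcap_(k in [set` s]) (X k @^-1` A k))
    = (\prod_(k <- s) P (X k @^-1` A k))%E.

Definition step_law (lambda1 lambda2 mu1 mu2 : R) (V : T -> int * int) : Prop :=
  [/\ P (V @^-1` [set ((1, 0) : int * int)]) = lambda1%:E,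
      P (V @^-1` [set ((0, 1) : int * int)]) = lambda2%:E,
      P (V @^-1` [set ((-1, 0) : int * int)]) = mu1%:E &
      P (V @^-1` [set ((0, -1) : int * int)]) = mu2%:E].

(* The sequence is indexed from 0: I k stands for I_{k+1}. *)
Definition iid_steps (lambda1 lambda2 mu1 mu2 : R) (I : nat -> T -> int * int) :
    Prop :=
  [/\ forall k, discrete_random (I k),
      mutually_independent I &
      forall k, step_law lambda1 lambda2 mu1 mu2 (I k)].

End Iid.

Definition quadrant : pred (int * int) := fun z => (0 <= z.1) && (0 <= z.2).
Definition half_plane : pred (int * int) := fun z => 0 <= z.2.

Fixpoint constrained_walk (D : pred (int * int)) (x : int * int)
    (v : nat -> int * int) (k : nat) : int * int :=
  if k is k'.+1 then
    let y := constrained_walk D x v k' in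
    if D (y + v k') then y + v k' else y
  else x.

Definition reflect_step (v : int * int) : int * int := (- v.1, v.2).

Definition T_map (n : nat) (x : int * int) : int * int := (n%:Z - x.1, x.2).

(* In the next three definitions i is one realization of the increments
   (I_{k+1})_k and x is the starting point of the walk. *)
Definition walkX (x : int * int) (i : nat -> int * int) : nat -> int * int :=
  constrained_walk quadrant x i.

Definition walkY (y : int * int) (i : nat -> int * int) : nat -> int * int :=
  constrained_walk half_plane y (fun k => reflect_step (i k)).

(* T_map n is an involution, so T_n(Y) starts at x when Y starts at T_n(x). *)
Definition walkXbar (n : nat) (x : int * int) (i : nat -> int * int)
    (k : nat) : int * int :=
  T_map n (walkY (T_map n x) i k).

Lemma walkXbarE n x i : walkXbar n x i =1 constrained_walk half_plane x i.
Proof.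
rewrite /walkXbar /walkY => k; elim: k => [|k IHk] /=.
  by rewrite /T_map /= opprB addrC subrK; case: x.
rewrite -{}IHk; set y := constrained_walk _ _ _ k.
rewrite /half_plane /reflect_step /T_map /=.
case: (y) (i k) => [a b] [u v] /=; case: ifP => // _.
congr (_, _).
by rewrite opprD opprK addrA.
Qed.

Section Hitting.
Variable R : realType.

(* inf{k >= 0 : Z_k in A}; the infimum of the empty set is +oo. *)
Definition hitting_time (A : set (int * int)) (Z : nat -> int * int) : \bar R :=
  ereal_inf [set k%:R%:E | k in [set k | A (Z k)]].

Definition tau_sum (n : nat) (Z : nat -> int * int) : \bar R :=
  hitting_time [set z | z.1 + z.2 = n%:Z] Z.

Definition tau_diag (Z : nat -> int * int) : \bar R :=
  hitting_time [set z | z.1 = z.2] Z.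

Definition scaled_start (x : R * R) (n : nat) : int * int :=
  (Num.floor (x.1 * n%:R), Num.floor (x.2 * n%:R)).

End Hitting.

Section Probabilities.
Context d (T : measurableType d) (R : realType) (P : probability T R).
Variable I : nat -> T -> int * int.

Definition prob_X (n : nat) (x : int * int) : R :=
  fine (P [set w | (tau_sum R n (walkX x (I^~ w))
                    < tau_sum R 0 (walkX x (I^~ w)))%E]).

Definition prob_Y (y : int * int) : R :=
  fine (P [set w | (tau_diag R (walkY y (I^~ w)) < +oo)%E]).

Definition prob_Xbar (n : nat) (x : int * int) : R :=
  fine (P [set w | (tau_sum R n (walkXbar n x (I^~ w)) < +oo)%E]).

End Probabilities.

(* Main.v *)
(* Off the origin the functions r^(n-x1-x2) and rho1^(n-x1) are subharmonic for
   the constrained walk, so P_x(tau_n < tau_0) is at least a constant times the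
   larger of the two as soon as x1 >= 1. The walks X and Xbar agree until they
   reach the axis x1 = 0, and from (0, z) either one reaches the line
   x1 + x2 = n with probability at most K (r^(n-z) + (t p)^n), where p = t rho1
   and t > 1 is as close to 1 as we like; here r^(n-x1-x2) is harmonic in the
   interior and its excess on the axes is absorbed by strict supersolutions.
   Extending this axis bound to the supersolution
   r^(n-x2) + C r^n p^(-x1) + (t p)^n shows that the two hitting probabilities
   differ by an exponentially smaller amount, because rho2 < r < rho1 strictly
   and x1 grows linearly in n. All estimates are made on the probabilities of
   hitting within k steps, which obey a one-step recursion, uniformly in k. *)

Require Import Defs.
From HB Require Import structures.
From mathcomp Require Import all_boot all_order all_algebra.
From mathcomp Require Import all_classical all_reals all_analysis.
From mathcomp Require Import zify ring lra.

Set Implicit Arguments.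
Unset Strict Implicit.
Unset Printing Implicit Defensive.

Import Order.TTheory GRing.Theory Num.Theory.
Import numFieldNormedType.Exports.

Local Open Scope classical_set_scope.
Local Open Scope ring_scope.

(** * Constrained moves and the regions that confine the walks *)

Definition move (D : pred (int * int)) (x v : int * int) : int * int :=
  if D (x + v) then x + v else x.

(** Started here, [X] stays here until it reaches level [n]; [below n] serves [Xbar] in the same
    way, with first coordinates allowed to be negative. *)
Definition triangle (n : nat) : pred (int * int) :=
  fun y => quadrant y && (y.1 + y.2 <= n%:Z).

Definition below (n : nat) : pred (int * int) :=
  fun y => half_plane y && (y.1 + y.2 <= n%:Z).

Definition level (n : nat) : pred (int * int) := fun y => y.1 + y.2 == n%:Z.

Lemma quadrant_level0 (y : int * int) : quadrant y -> level 0 y -> y = (0, 0).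
Proof.
case: y => a b; rewrite /quadrant /level /= => /andP[a0 b0] /eqP ab.
by congr (_, _); lia.
Qed.

(** * The one-step averaging operator and its action on monomials *)

Section OneStep.
Variables (R : realType) (l1 l2 m1 m2 : R).

Definition mean (D : pred (int * int)) (f : int * int -> R) (x : int * int) : R :=
  l1 * f (move D x (1, 0)) + l2 * f (move D x (0, 1))
  + m1 * f (move D x (-1, 0)) + m2 * f (move D x (0, -1)).

Definition monomial (a b : R) (x : int * int) : R := a ^ x.1 * b ^ x.2.

(* The probability of visiting N within k steps before any visit to Z; a common
   point of N and Z counts as a visit to N. *)
Fixpoint hit_prob (D N Z : pred (int * int)) (k : nat) (x : int * int) : R :=
  if N x then 1 else if Z x then 0 else
  if k is k'.+1 then mean D (hit_prob D N Z k') x else 0.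

Lemma int_pairD (a b c d : int) : (a, b) + (c, d) = (a + c, b + d).
Proof. by []. Qed.

Lemma move_quadrant (x : int * int) : quadrant x ->
  [/\ move quadrant x (1, 0) = (x.1 + 1, x.2),
      move quadrant x (0, 1) = (x.1, x.2 + 1),
      move quadrant x (-1, 0) = (if x.1 == 0 then x.1 else x.1 - 1, x.2) &
      move quadrant x (0, -1) = (x.1, if x.2 == 0 then x.2 else x.2 - 1)].
Proof.
case: x => x1 x2; rewrite /move /quadrant !int_pairD /= !addr0 => /andP[h1 h2].
split.
- by rewrite ifT //; lia.
- by rewrite ifT //; lia.
- by case: eqP => ?; [rewrite ifF | rewrite ifT] => //; lia.
- by case: eqP => ?; [rewrite ifF | rewrite ifT] => //; lia.
Qed.

Lemma move_half_plane (x : int * int) : half_plane x ->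
  [/\ move half_plane x (1, 0) = (x.1 + 1, x.2),
      move half_plane x (0, 1) = (x.1, x.2 + 1),
      move half_plane x (-1, 0) = (x.1 - 1, x.2) &
      move half_plane x (0, -1) = (x.1, if x.2 == 0 then x.2 else x.2 - 1)].
Proof.
case: x => x1 x2; rewrite /move /half_plane !int_pairD /= !addr0 => h2.
split.
- by rewrite ifT //; lia.
- by rewrite ifT //; lia.
- by rewrite ifT //; lia.
- by case: eqP => ?; [rewrite ifF | rewrite ifT] => //; lia.
Qed.

(** The constraints differ only by the suppression at [x1 = 0]; this lets [X] and [Xbar] share their
    steps until that axis is reached. *)
Lemma move_quadrant_half_plane (y v : int * int) : quadrant y -> 0 < y.1 ->
  v \in [:: (1, 0); (0, 1); (-1, 0); (0, -1)] ->
  move quadrant y v = move half_plane y v.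
Proof.
move=> qy y1; have [_ y2] := andP qy.
have [e1 e2 e3 e4] := move_quadrant qy; have [f1 f2 f3 f4] := move_half_plane y2.
rewrite !inE => /orP[/eqP->|/orP[/eqP->|/orP[/eqP->|/eqP->]]];
  by rewrite ?(e1, e2, e3, e4) ?(f1, f2, f3, f4) ?(gt_eqF y1).
Qed.

Lemma expfzD1 (a : R) (i : int) : a != 0 -> a ^ (i + 1) = a ^ i * a.
Proof. by move=> a0; rewrite expfzDr. Qed.

Lemma expfzB1 (a : R) (i : int) : a != 0 -> a ^ (i - 1) = a ^ i * a^-1.
Proof. by move=> a0; rewrite expfzDr. Qed.

(** The bracket depends only on which axes the point touches, so comparing it with 1 decides between
    sub- and supersolution. *)
Lemma mean_quadrant_monomial (a b : R) (x : int * int) :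
  a != 0 -> b != 0 -> quadrant x ->
  mean quadrant (monomial a b) x = monomial a b x *
    (l1 * a + l2 * b + m1 * (if x.1 == 0 then 1 else a^-1)
     + m2 * (if x.2 == 0 then 1 else b^-1)).
Proof.
move=> a0 b0 qx; rewrite /mean.
have [-> -> -> ->] := move_quadrant qx; rewrite /monomial /=.
by case: eqP => _; case: eqP => _; rewrite ?expfzD1 ?expfzB1 //; ring.
Qed.

Lemma mean_half_plane_monomial (a b : R) (x : int * int) :
  a != 0 -> b != 0 -> half_plane x ->
  mean half_plane (monomial a b) x = monomial a b x *
    (l1 * a + l2 * b + m1 * a^-1 + m2 * (if x.2 == 0 then 1 else b^-1)).
Proof.
move=> a0 b0 qx; rewrite /mean.
have [-> -> -> ->] := move_half_plane qx; rewrite /monomial /=.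
by case: eqP => _; rewrite ?expfzD1 ?expfzB1 //; ring.
Qed.

(** * Comparison principles for finite-horizon hitting probabilities *)

Hypothesis l1_gt0 : 0 < l1.
Hypothesis l2_gt0 : 0 < l2.
Hypothesis m1_gt0 : 0 < m1.
Hypothesis m2_gt0 : 0 < m2.
Hypothesis sum1 : l1 + l2 + m1 + m2 = 1.

Lemma ler_mean (D : pred (int * int)) (f g : int * int -> R) (x : int * int) :
  (forall v, v \in [:: (1, 0); (0, 1); (-1, 0); (0, -1)] ->
    f (move D x v) <= g (move D x v)) ->
  mean D f x <= mean D g x.
Proof.
move=> fg; rewrite /mean.
by rewrite !lerD// ler_pM2l// fg// !inE eqxx ?orbT.
Qed.

Lemma meanD (D : pred (int * int)) (f g : int * int -> R) (x : int * int) :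
  mean D (fun y => f y + g y) x = mean D f x + mean D g x.
Proof. by rewrite /mean; ring. Qed.

Lemma meanZ (D : pred (int * int)) (c : R) (f : int * int -> R) (x : int * int) :
  mean D (fun y => c * f y) x = c * mean D f x.
Proof. by rewrite /mean; ring. Qed.

Lemma mean_cst (D : pred (int * int)) (c : R) (x : int * int) :
  mean D (fun=> c) x = c.
Proof.
by rewrite /mean -!mulrDl sum1 mul1r.
Qed.

Lemma hit_prob_ge0 (D N Z : pred (int * int)) k x : 0 <= hit_prob D N Z k x.
Proof.
elim: k x => [|k IH] x /=; case: ifP => // _; case: ifP => // _.
by rewrite -(mean_cst D 0 x); apply: ler_mean => v _; exact: IH.
Qed.

(** Maximum principle, by induction on the horizon. The region [Q], closed under moves until
    absorption, limits where [h] has to be controlled. *)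
Lemma hit_prob_le (D N Z Q : pred (int * int)) (h : int * int -> R) k x :
  (forall y, Q y -> ~~ N y -> ~~ Z y ->
    forall v, v \in [:: (1, 0); (0, 1); (-1, 0); (0, -1)] -> Q (move D y v)) ->
  (forall y, Q y -> 0 <= h y) ->
  (forall y, Q y -> N y -> 1 <= h y) ->
  (forall y, Q y -> ~~ N y -> ~~ Z y -> mean D h y <= h y) ->
  Q x -> hit_prob D N Z k x <= h x.
Proof.
move=> Qm h0 h1 hm; elim: k x => [|k IH] x Qx /=; case: ifPn => Nx; try exact: h1;
  case: ifPn => Zx; try exact: h0.
apply: le_trans (hm _ Qx Nx Zx); apply: ler_mean => v vS.
by apply: IH; apply: Qm.
Qed.

(* The strict supersolution psi makes absorption geometrically fast. *)
Lemma hit_prob_ge (D N Z Q : pred (int * int)) (f psi : int * int -> R) (e q : R) k x :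
  (forall y, Q y -> ~~ N y -> ~~ Z y ->
    forall v, v \in [:: (1, 0); (0, 1); (-1, 0); (0, -1)] -> Q (move D y v)) ->
  0 <= e -> 0 <= q ->
  (forall y, Q y -> f y <= 1) ->
  (forall y, Q y -> Z y -> f y <= e) ->
  (forall y, Q y -> 1 <= psi y) ->
  (forall y, Q y -> ~~ N y -> ~~ Z y -> f y <= mean D f y) ->
  (forall y, Q y -> ~~ N y -> ~~ Z y -> mean D psi y <= q * psi y) ->
  Q x -> f x - e - q ^+ k * psi x <= hit_prob D N Z k x.
Proof.
move=> Qm e0 q0 f1 fe psi1 fm psim; elim: k x => [|k IH] x Qx /=.
  have := f1 _ Qx; have := psi1 _ Qx; rewrite expr0 mul1r => ? ?.
  case: ifP => _; last case: ifP => _; lra.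
have qp : 0 <= q ^+ k.+1 * psi x.
  by rewrite mulr_ge0 ?exprn_ge0// (le_trans ler01)// psi1.
case: ifPn => Nx; first by have := f1 _ Qx; lra.
case: ifPn => Zx; first by have := fe _ Qx Zx; lra.
apply: (@le_trans _ _ (mean D (fun y => f y - e - q ^+ k * psi y) x)); last first.
  by apply: ler_mean => v vS; apply: IH; apply: Qm.
have -> : mean D (fun y => f y - e - q ^+ k * psi y) x
    = mean D f x - e - q ^+ k * mean D psi x.
  have -> : (fun y => f y - e - q ^+ k * psi y)
    = (fun y => (f y + - e) + (- q ^+ k) * psi y) by apply/funext => y; ring.
  by rewrite meanD meanD meanZ mean_cst; ring.
have := fm _ Qx Nx Zx; have := psim _ Qx Nx Zx.
move=> /(ler_wpM2l (exprn_ge0 k q0)); rewrite exprSr => ? ?; lra.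
Qed.

(** The error [q ^+ k * psi x] of the preceding bound vanishes as [k] grows, so only the value [e]
    on [Z] is lost. *)
Lemma hit_prob_ge_sup (D N Z Q : pred (int * int)) (f psi : int * int -> R)
    (e q U : R) x :
  (forall y, Q y -> ~~ N y -> ~~ Z y ->
    forall v, v \in [:: (1, 0); (0, 1); (-1, 0); (0, -1)] -> Q (move D y v)) ->
  0 <= e -> 0 <= q < 1 ->
  (forall y, Q y -> f y <= 1) ->
  (forall y, Q y -> Z y -> f y <= e) ->
  (forall y, Q y -> 1 <= psi y) ->
  (forall y, Q y -> ~~ N y -> ~~ Z y -> f y <= mean D f y) ->
  (forall y, Q y -> ~~ N y -> ~~ Z y -> mean D psi y <= q * psi y) ->
  Q x -> (forall k, hit_prob D N Z k x <= U) -> f x <= U + e.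
Proof.
move=> Qm e0 /andP[q0 q1] f1 fe psi1 fm psim Qx hU.
rewrite leNgt; apply/negP => Uf.
have e'0 : 0 < f x - e - U by lra.
have /cvgrPdist_lt/(_ _ e'0)[k _ /(_ k (leqnn k))] :=
  @cvg_geometric R (psi x) q ltac:(by rewrite ger0_norm).
rewrite sub0r normrN /= ger0_norm; last first.
  by rewrite mulr_ge0 ?exprn_ge0// (le_trans ler01)// psi1.
have := hU k.
by have := hit_prob_ge k Qm e0 q0 f1 fe psi1 fm psim Qx; lra.
Qed.

Lemma triangle_move n y : triangle n y -> ~~ level n y ->
  forall v, v \in [:: (1, 0); (0, 1); (-1, 0); (0, -1)] ->
    triangle n (move quadrant y v).
Proof.
rewrite /triangle /level => /andP[qy sy] /eqP ny v.
have [e1 e2 e3 e4] := move_quadrant qy; move: qy; rewrite /quadrant => qy.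
rewrite !inE => /orP[/eqP->|/orP[/eqP->|/orP[/eqP->|/eqP->]]];
  rewrite ?(e1, e2, e3, e4) /=; do ?case: eqP => ?; lia.
Qed.

Lemma below_move n y : below n y -> ~~ level n y ->
  forall v, v \in [:: (1, 0); (0, 1); (-1, 0); (0, -1)] ->
    below n (move half_plane y v).
Proof.
rewrite /below /level => /andP[qy sy] /eqP ny v.
have [e1 e2 e3 e4] := move_half_plane qy; move: qy; rewrite /half_plane => qy.
rewrite !inE => /orP[/eqP->|/orP[/eqP->|/orP[/eqP->|/eqP->]]];
  rewrite ?(e1, e2, e3, e4) /=; do ?case: eqP => ?; lia.
Qed.

(** * Bounds on monomials and the lower bound for the constrained walk *)

Lemma exprz_ge1 (a : R) (i : int) : 1 <= a -> 0 <= i -> 1 <= a ^ i.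
Proof. by case: i => // i a1 _; rewrite -exprnP exprn_ege1. Qed.

Lemma ler_exprz (a b : R) (i : int) : 0 <= a -> a <= b -> 0 <= i -> a ^ i <= b ^ i.
Proof. by case: i => // i a0 ab _; rewrite -!exprnP lerXn2r// nnegrE (le_trans a0). Qed.

Lemma monomial_gt0 (a b : R) y : 0 < a -> 0 < b -> 0 < monomial a b y.
Proof. by move=> a0 b0; rewrite mulr_gt0// exprz_gt0. Qed.

Lemma monomial_ge1 (a b : R) y : 1 <= a -> 1 <= b -> quadrant y -> 1 <= monomial a b y.
Proof.
move=> a1 b1 /andP[y1 y2]; rewrite -[leLHS]mulr1.
by rewrite ler_pM// exprz_ge1.
Qed.

Lemma monomial_le (a : R) n y : 1 <= a -> y.1 + y.2 <= n%:Z ->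
  monomial a a y <= a ^+ n.
Proof.
move=> a1 sy; have a0 : a != 0 by rewrite gt_eqF// (lt_le_trans ltr01).
rewrite /monomial -expfzDr// exprnP.
by rewrite ler_weXz2l.
Qed.

Lemma arrival_le1 : l1 + l2 <= 1.
Proof. by move: sum1 m1_gt0 m2_gt0; lra. Qed.

(** The power [C ^ (y1 + y2)] grows on average by a factor at least [1 + (m1 + m2) * (l1 + l2)]:
    arrivals contribute [(l1 + l2) * C = 1], and departures, suppressed or not, at least the rest.
    Hence [psi] drops by a fixed amount, which is a contraction because [psi <= C ^+ n + 1]. *)
Lemma mean_absorption n (C := (l1 + l2)^-1)
    (psi := fun y => C ^+ n + 1 - monomial C C y) y : triangle n y ->
  mean quadrant psi y <= (1 - (m1 + m2) * (l1 + l2) / (C ^+ n + 1)) * psi y.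
Proof.
case/andP=> qy sy.
have l0 : 0 < l1 + l2 by rewrite addr_gt0.
have l1' := arrival_le1.
have C1 : 1 <= C by rewrite invf_ge1.
have C0 : 0 < C by rewrite (lt_le_trans ltr01).
have Cn0 : C != 0 by rewrite gt_eqF.
have M1 := monomial_ge1 C1 C1 qy.
have Mn := monomial_le C1 sy.
have -> : mean quadrant psi y = C ^+ n + 1 - mean quadrant (monomial C C) y.
  have -> : psi = (fun y => (C ^+ n + 1) + (- 1) * monomial C C y).
    by apply/funext => z; rewrite /psi; ring.
  by rewrite meanD meanZ mean_cst; ring.
rewrite mean_quadrant_monomial// /psi.
set M := monomial C C y in M1 Mn *.
set F := l1 * C + _ + _ + _.
have lC : (l1 + l2) * C = 1 by rewrite mulfV// gt_eqF.
have F1 : 1 + (m1 + m2) * (l1 + l2) <= F.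
  have Ci : C^-1 = l1 + l2 by rewrite invrK.
  rewrite /F Ci; clearbody C.
  have : m1 * (l1 + l2) <= m1 * (if y.1 == 0 then 1 else l1 + l2).
    by rewrite ler_pM2l//; case: ifP.
  have : m2 * (l1 + l2) <= m2 * (if y.2 == 0 then 1 else l1 + l2).
    by rewrite ler_pM2l//; case: ifP.
  move: (if _ then _ else _) (if _ then _ else _) => u v.
  by move=> ? ?; lra.
have D0 : 0 < C ^+ n + 1 by rewrite ltr_wpDl// exprn_ge0// ltW.
have ml0 : 0 < (m1 + m2) * (l1 + l2) by rewrite mulr_gt0// addr_gt0.
have : M * (1 + (m1 + m2) * (l1 + l2)) <= M * F.
  by rewrite ler_wpM2l// (le_trans ler01).
have : (m1 + m2) * (l1 + l2) / (C ^+ n + 1) * (C ^+ n + 1 - M)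
    <= (m1 + m2) * (l1 + l2).
  rewrite -mulrA ger_pMr// mulrC ler_pdivrMr//; lra.
have : (m1 + m2) * (l1 + l2) <= M * ((m1 + m2) * (l1 + l2)).
  by rewrite ler_peMl// ltW.
clearbody F; move: (_ / (_ + 1)) => G *; lra.
Qed.

(** The left side is a subsolution: the hypothesis on the one-step sum covers the interior, and
    suppression only replaces [c] or [b^-1] by the larger value 1. The condition [b * c <= 1] keeps
    it at most 1 on the triangle, and its value [c ^+ n] at the origin is the error. *)
Lemma hit_prob_monomial_ge (c b U : R) n x :
  0 < c -> 1 <= b -> b * c <= 1 -> 1 <= l1 * c^-1 + l2 * b + m1 * c + m2 * b^-1 ->
  triangle n x ->
  (forall k, hit_prob quadrant (level n) (level 0) k x <= U) ->
  c ^+ n * monomial c^-1 b x <= U + c ^+ n.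
Proof.
move=> c0 b1 bc F1 Tx.
have b0 : 0 < b by rewrite (lt_le_trans ltr01).
have c1 : c <= 1 by rewrite (le_trans _ bc)// ler_peMl// ltW.
have l0 : 0 < l1 + l2 by rewrite addr_gt0.
set C := (l1 + l2)^-1.
have C1 : 1 <= C by rewrite invf_ge1// arrival_le1.
have C0 : 0 < C by rewrite (lt_le_trans ltr01).
have D1 : 1 < C ^+ n + 1 by rewrite ltrDr exprn_gt0.
have cn0 : 0 < c ^+ n by rewrite exprn_gt0.
pose psi := fun y => C ^+ n + 1 - monomial C C y.
apply: (@hit_prob_ge_sup quadrant (level n) (level 0) (triangle n)
  (fun y => c ^+ n * monomial c^-1 b y) psi (c ^+ n)
  (1 - (m1 + m2) * (l1 + l2) / (C ^+ n + 1))) => //.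
- by move=> y Ty Ny _; exact: triangle_move.
- exact: ltW.
- have D0 := lt_trans ltr01 D1.
  have G0 : 0 < (m1 + m2) * (l1 + l2) / (C ^+ n + 1).
    by rewrite divr_gt0// mulr_gt0// addr_gt0.
  have G1 : (m1 + m2) * (l1 + l2) / (C ^+ n + 1) <= 1.
    rewrite ler_pdivrMr// mul1r (le_trans _ (ltW D1))//.
    apply: mulr_ile1; rewrite ?arrival_le1 ?addr_ge0 ?ltW//.
    by move: sum1 l1_gt0 l2_gt0; lra.
  move: (_ / _) G0 G1 => G G0 G1; lra.
- move=> y /andP[qy sy].
  rewrite -(@ler_pM2l _ (c^-1 ^+ n)) ?exprn_gt0 ?invr_gt0//.
  rewrite mulrA -exprMn mulVf ?gt_eqF// expr1n mul1r mulr1.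
  apply: le_trans (monomial_le (n := n) _ sy); last by rewrite invf_ge1.
  move: qy => /andP[y1 y2].
  apply: ler_wpM2l; first by rewrite exprz_ge0// invr_ge0 ltW.
  apply: ler_exprz => //; first exact: ltW.
  by rewrite -(ler_pM2r c0) mulVf ?gt_eqF.
- move=> y /andP[qy _] y0; rewrite (quadrant_level0 qy y0).
  by rewrite /monomial /= !expr0z !mulr1.
- move=> y /andP[qy sy]; have := monomial_le C1 sy; rewrite /psi; lra.
- move=> y /andP[qy _] _ _; rewrite meanZ ler_pM2l//.
  have cV0 : c^-1 != 0 by rewrite invr_eq0 gt_eqF.
  rewrite mean_quadrant_monomial// ?(gt_eqF b0)// invrK.
  apply: ler_peMr; first by rewrite ltW// monomial_gt0// invr_gt0.
  apply: le_trans F1 _; rewrite !lerD// ler_pM2l//; case: ifP => // _.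
  by rewrite invf_le1.
- by move=> y Ty _ _; exact: mean_absorption.
Qed.

Lemma monomial1l (b : R) y : monomial 1 b y = b ^ y.2.
Proof. by rewrite /monomial exp1rz mul1r. Qed.

Lemma monomial1r (a : R) y : monomial a 1 y = a ^ y.1.
Proof. by rewrite /monomial exp1rz mulr1. Qed.

Lemma exprz_unbounded (a c : R) : 1 < a -> exists k : nat, c <= a ^+ k.
Proof.
move=> a1; have a0 : 0 < a by rewrite (lt_trans ltr01).
have c0 : 0 < `|c| + 1 by rewrite ltr_wpDl.
have e0 : 0 < (`|c| + 1)^-1 by rewrite invr_gt0.
have /cvgrPdist_lt/(_ _ e0)[k _ /(_ k (leqnn k))] :=
  @cvg_geometric R 1 a^-1 ltac:(by rewrite ger0_norm ?invr_ge0 ?ltW// invf_lt1).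
rewrite sub0r normrN /= mul1r ger0_norm ?exprn_ge0 ?invr_ge0 ?ltW//.
rewrite exprVn ltf_pV2 ?posrE ?exprn_gt0// => h; exists k.
by have := ler_norm c; lra.
Qed.

(** * Supersolutions, upper bounds on the axis, and the coupling estimate *)

Section Supersolutions.
Variables (p t r : R).
Hypothesis r_gt0 : 0 < r.
Hypothesis r_lt1 : r < 1.
Hypothesis rE : l1 + l2 = r * (m1 + m2).
Hypothesis l2_lt : l2 < r * m2.
Hypothesis r_le_p : r <= p.
Hypothesis p_lt1 : p < 1.
Hypothesis l1_lt : l1 < p * m1.
Hypothesis t_gt1 : 1 < t.
Hypothesis tl2_lt : t * l2 < m2.

Let p_gt0 : 0 < p. Proof. exact: lt_le_trans r_le_p. Qed.
Let t_gt0 : 0 < t. Proof. exact: lt_trans t_gt1. Qed.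
Let pV_gt1 : 1 < p^-1. Proof. by rewrite invf_gt1. Qed.
Let rV_gt1 : 1 < r^-1. Proof. by rewrite invf_gt1. Qed.
Let pV_gt0 : 0 < p^-1. Proof. by rewrite invr_gt0. Qed.
Let rV_gt0 : 0 < r^-1. Proof. by rewrite invr_gt0. Qed.

(** The three gaps are the amounts by which the one-step factors of [p^-1 ^ x1], [t ^ x2] and
    [r^-1 ^ x2] fall below 1 where no step changing that coordinate is suppressed. *)
Let gap_p := (1 - p) * (m1 - l1 * p^-1).
Let gap_t := (t - 1) * (m2 * t^-1 - l2).
Let gap_r := (r^-1 - 1) * (m2 * r - l2).

Let gap_p_gt0 : 0 < gap_p.
Proof. by rewrite mulr_gt0 ?subr_gt0// ltr_pdivrMr// mulrC. Qed.

Let gap_t_gt0 : 0 < gap_t.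
Proof. by rewrite mulr_gt0 ?subr_gt0// ltr_pdivlMr// mulrC. Qed.

Let gap_r_gt0 : 0 < gap_r.
Proof. by rewrite mulr_gt0 ?subr_gt0// mulrC. Qed.

Let factor_p : l1 * p^-1 + l2 + m1 * p + m2 = 1 - gap_p.
Proof.
rewrite /gap_p; have := mulfV (lt0r_neq0 p_gt0); move: p^-1 => q pq.
have -> : (1 - p) * (m1 - l1 * q) = m1 - l1 * q - p * m1 + l1 * (p * q) by ring.
rewrite pq; move: sum1; lra.
Qed.

Let factor_t : l1 + l2 * t + m1 + m2 * t^-1 = 1 - gap_t.
Proof.
rewrite /gap_t; have := mulfV (lt0r_neq0 t_gt0); move: t^-1 => q tq.
have -> : (t - 1) * (m2 * q - l2) = m2 * (t * q) - l2 * t - m2 * q + l2 by ring.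
rewrite tq; move: sum1; lra.
Qed.

Let factor_r : l1 + l2 * r^-1 + m1 + m2 * r = 1 - gap_r.
Proof.
rewrite /gap_r; have := mulfV (lt0r_neq0 r_gt0); move: r^-1 => q rq.
have -> : (q - 1) * (m2 * r - l2) = m2 * (r * q) - l2 * q - m2 * r + l2 by ring.
rewrite rq; move: sum1; lra.
Qed.

Let factor_rr : l1 * r^-1 + l2 * r^-1 + m1 * r + m2 * r = 1.
Proof.
have := mulfV (lt0r_neq0 r_gt0); move: r^-1 => q rq.
have e : (l1 + l2) * q = m1 + m2 by rewrite rE mulrAC rq mul1r.
by move: sum1 rE e; lra.
Qed.

(** With this choice a single available departure contributes [m1 / kappa = 1 / m2] or
    [m2 / kappa = 1 / m1], already above 1, so one positive coordinate suffices. *)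
Let kappa := m1 * m2.

Let m_lt1 : m1 < 1 /\ m2 < 1.
Proof. by split; move: sum1 l1_gt0 l2_gt0 m1_gt0 m2_gt0; lra. Qed.

Let kappa_gt0 : 0 < kappa. Proof. exact: mulr_gt0. Qed.

Let kappa_lt1 : kappa < 1.
Proof. by case: m_lt1 => a b; rewrite mulr_ilt1// ltW. Qed.

Let gap_k := (1 - kappa) * (m1 + m2).

Let gap_k_gt0 : 0 < gap_k.
Proof. by rewrite mulr_gt0 ?subr_gt0 ?addr_gt0. Qed.

(* Near the origin the negative power kappa^(y1+y2) is a strict subsolution,
   boundaries included. *)
Let mean_kappa y : quadrant y -> ~~ level 0 y ->
  (1 + gap_k) * monomial kappa kappa y <= mean quadrant (monomial kappa kappa) y.
Proof.
move=> qy y0; have k0 : kappa != 0 by rewrite gt_eqF.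
rewrite mean_quadrant_monomial// mulrC ler_pM2l ?monomial_gt0//.
have [m1lt m2lt] := m_lt1.
have e1 : m1 * kappa^-1 = m2^-1 by rewrite /kappa invfM mulrA mulfV ?gt_eqF// mul1r.
have e2 : m2 * kappa^-1 = m1^-1.
  by rewrite /kappa invfM [X in _ * X]mulrC mulrA mulfV ?gt_eqF// mul1r.
(* This bound and the next are tuned so that on a single axis the one-step factor is at least
   [1 + gap_k]. *)
have h1 : 1 + m2 * (1 - m1) <= m1^-1.
  rewrite -[leRHS]mul1r ler_pdivlMr//.
  have : m1 * m2 <= 1 by exact: ltW.
  move=> h; have : 0 <= (1 - m1) * (1 - m1 * m2) by rewrite mulr_ge0 ?subr_ge0// ltW.
  lra.
have h2 : 1 + m1 * (1 - m2) <= m2^-1.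
  rewrite -[leRHS]mul1r ler_pdivlMr//.
  have : m1 * m2 <= 1 by exact: ltW.
  move=> h; have : 0 <= (1 - m2) * (1 - m1 * m2) by rewrite mulr_ge0 ?subr_ge0// ltW.
  lra.
have h3 : 0 <= m2 * (1 - m1) by rewrite mulr_ge0 ?subr_ge0 ?ltW.
have h4 : 0 <= m1 * (1 - m2) by rewrite mulr_ge0 ?subr_ge0 ?ltW.
have s1 : l1 = 1 - l2 - m1 - m2 by rewrite -sum1; ring.
rewrite /gap_k s1.
case: eqP => y1; case: eqP => y2; rewrite ?mulr1 ?e1 ?e2.
- by move: y0; rewrite /level y1 y2.
- by move: m1^-1 h1 => q h1; rewrite /kappa; lra.
- by move: m2^-1 h2 => q h2; rewrite /kappa; lra.
- by move: m1^-1 m2^-1 h1 h2 => q1 q2 h1 h2; rewrite /kappa; lra.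
Qed.

(* p^(-x1) fails to be a supersolution on x1 = 0 only; B t^x2 repairs this, at
   the price of an excess on x2 = 0 that matters only close to the origin, where
   M (1 - kappa^(x1+x2)) absorbs it. *)
Let corrector (B M : R) (y : int * int) : R :=
  monomial p^-1 1 y + (B * monomial 1 t y + (M + (- M) * monomial kappa kappa y)).

Let mean_corrector B M y :
  mean quadrant (corrector B M) y
  = mean quadrant (monomial p^-1 1) y + (B * mean quadrant (monomial 1 t) y
     + (M - M * mean quadrant (monomial kappa kappa) y)).
Proof. by rewrite /corrector !meanD !meanZ mean_cst mulNr. Qed.

(** Half of [gap_p] is spent on the defects of the corrector itself; the other half is kept, off
    [x1 = 0], to pay for powers of [r^-1] later. *)
Let corrector_supersolution : exists B M, [/\ 0 <= B, 0 <= M &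
  forall y, quadrant y -> ~~ level 0 y ->
    mean quadrant (corrector B M) y <= corrector B M y
      - (if y.1 == 0 then 0 else gap_p / 2 * p^-1 ^ y.1)].
Proof.
(* The decay [B * gap_t] of the [t ^ x2] term matches the excess of [p^-1 ^ x1] on [x1 = 0]. *)
pose B := l1 * (p^-1 - 1) / gap_t.
have lP0 : 0 < l1 * (p^-1 - 1) by apply: mulr_gt0 => //; rewrite subr_gt0.
have B0 : 0 <= B by apply/ltW/divr_gt0.
(* From [x1 = k] on, half of the gap of [p^-1 ^ x1] outweighs the excess of [B * t ^ x2] on
   [x2 = 0]. *)
have [k hk] := exprz_unbounded (B * (l2 * (t - 1)) / (gap_p / 2)) pV_gt1.
rewrite ler_pdivrMr ?divr_gt0// [leRHS]mulrC in hk.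
(* For [x1 < k] and [x2 = 0], [kappa ^ x1 >= kappa ^+ k], so the [kappa] term absorbs the same
   excess. *)
pose M := B * (l2 * (t - 1)) / (gap_k * kappa ^+ k).
have Bt : 0 <= B * (l2 * (t - 1)).
  by rewrite mulr_ge0// ltW// mulr_gt0// subr_gt0.
have M0 : 0 <= M by rewrite divr_ge0// ltW// mulr_gt0// exprn_gt0.
exists B, M; split=> // y qy y0.
have hkap := mean_kappa qy y0.
have n0 : kappa != 0 by rewrite gt_eqF.
have n1 : p^-1 != 0 by rewrite gt_eqF.
have n2 : t != 0 by rewrite gt_eqF.
rewrite mean_corrector.
move/(ler_wpM2l M0): hkap; rewrite mulrDl mul1r mulrDr.
move: (mean _ (monomial kappa _) _) => K.
rewrite !mean_quadrant_monomial ?oner_neq0//.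
rewrite /corrector !monomial1l !monomial1r invrK invr1 !mulr1 !if_same !mulr1.
have [q1 q2] := andP qy.
have t1 : 1 <= t ^ y.2 by rewrite exprz_ge1// ltW.
have k0 : 0 < monomial kappa kappa y by exact: monomial_gt0.
have P0 : 0 < p^-1 ^ y.1 by exact: exprz_gt0.
have MK0 : 0 <= M * (gap_k * monomial kappa kappa y).
  by rewrite mulr_ge0// ltW// mulr_gt0.
have Bd : B * gap_t = l1 * (p^-1 - 1) by rewrite /B divfK// gt_eqF.
have BT0 : 0 <= B * gap_t * t ^ y.2 by rewrite Bd mulr_ge0// ltW// exprz_gt0.
case: eqP => y1; rewrite /= ?mulr1.
- have -> : (y.2 == 0) = false.
    by apply/negP => /eqP y2; move: y0; rewrite /level y1 y2.
  have -> : l1 + l2 * t + m1 + m2 / t = 1 - gap_t by exact: factor_t.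
  rewrite /= y1 expr0z mul1r.
  have -> : l1 / p + l2 + m1 + m2 = 1 + l1 * (p^-1 - 1) by move: sum1; lra.
  have : l1 * (p^-1 - 1) <= B * gap_t * t ^ y.2 by rewrite Bd ler_peMr// ltW.
  move=> h hK; move: MK0; lra.
- have -> : l1 / p + l2 + m1 * p + m2 = 1 - gap_p by exact: factor_p.
  case: eqP => y2; rewrite /= ?mulr1; last first.
    have -> : l1 + l2 * t + m1 + m2 / t = 1 - gap_t by exact: factor_t.
    have : 0 <= gap_p * p^-1 ^ y.1 by rewrite mulr_ge0// ltW.
    move=> h hK; move: MK0 BT0; lra.
  have -> : l1 + l2 * t + m1 + m2 = 1 + l2 * (t - 1) by move: sum1; lra.
  rewrite y2 expr0z.
  suff h : B * (l2 * (t - 1)) <= gap_p / 2 * p^-1 ^ y.1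
      + M * (gap_k * monomial kappa kappa y) by move=> hK; lra.
  have Pp0 : 0 <= gap_p / 2 * p^-1 ^ y.1 by rewrite mulr_ge0 ?divr_ge0// ltW.
  have [kn|kn] := leP k%:Z y.1.
    apply: (@le_trans _ _ (gap_p / 2 * p^-1 ^ y.1)); last by rewrite lerDl.
    apply: (le_trans hk); rewrite ler_pM2l ?divr_gt0// exprnP.
    by rewrite ler_weXz2l// ltW.
  apply: (@le_trans _ _ (M * (gap_k * monomial kappa kappa y))); last by rewrite lerDr.
  rewrite /M [leRHS]mulrAC ler_pdivlMr; last first.
    by apply: mulr_gt0 => //; exact: exprn_gt0.
  rewrite ler_wpM2l// ler_pM2l// /monomial y2 expr0z mulr1 exprnP.
  by rewrite ler_wpiXz2l ?ltW.
Qed.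

Let scale (c : R) (n : nat) (i : int) : 0 < c -> c ^+ n * c^-1 ^ i = c ^ (n%:Z - i).
Proof. by move=> c0; rewrite expfzDr ?gt_eqF// -exprz_inv exprnP. Qed.

Let monomialE (c : R) n y : 0 < c -> level n y -> c ^+ n * monomial c^-1 c^-1 y = 1.
Proof.
move=> c0 /eqP yn; rewrite /monomial -expfzDr ?invr_eq0 ?gt_eqF// yn scale//.
by rewrite subrr expr0z.
Qed.

Let scale_le n (i : int) : i <= n%:Z -> r ^+ n * r^-1 ^ i <= p ^+ n * p^-1 ^ i.
Proof.
by move=> ni; rewrite !scale//; apply: ler_exprz; rewrite ?subr_ge0// ltW.
Qed.

Let kappa_le1 y : quadrant y -> monomial kappa kappa y <= 1.
Proof.
move=> /andP[y1 y2]; have k1 := ltW kappa_lt1; have k0 := ltW kappa_gt0.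
rewrite /monomial mulr_ile1 ?exprz_ge0//.
  by rewrite -(exp1rz R y.1) ler_exprz.
by rewrite -(exp1rz R y.2) ler_exprz.
Qed.

Let exprVr_ge0 (c : R) n (i : int) : 0 < c -> 0 <= c ^+ n * c^-1 ^ i.
Proof. by move=> c0; rewrite mulr_ge0 ?exprn_ge0 ?exprz_ge0 ?invr_ge0 ?ltW. Qed.

Let r1_gt0 : 0 < 1 - r. Proof. by rewrite subr_gt0. Qed.
Let rV1_gt0 : 0 < r^-1 - 1. Proof. by rewrite subr_gt0. Qed.
Let gap_p_gt0' : 0 < gap_p / 2. Proof. by rewrite divr_gt0. Qed.

Lemma hit_prob_quadrant_axis : exists K, 0 <= K /\
  forall n k (z : int), 0 <= z <= n%:Z ->
    hit_prob quadrant (level n) (level 0) k (0, z)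
    <= K * (r ^+ n * r^-1 ^ z + (t * p) ^+ n).
Proof.
have [B [M [B0 M0 sup]]] := corrector_supersolution.
(* On [x1 = 0] the mean of [r ^ (n - x1 - x2)] has relative excess [m1 * (1 - r)]; the gap of
   [C2 * r ^ (n - x2)] cancels it. *)
pose C2 := m1 * (1 - r) / gap_r.
have C20 : 0 <= C2 by apply/ltW/divr_gt0 => //; exact: mulr_gt0.
(* On [x2 = 0] both powers of [r] have an excess. Since [r ^+ n <= r ^ (n - x1) <= p ^ (n - x1)]
   there, the spare half of [gap_p] covers their sum. *)
pose C1 := (m2 * (1 - r) + C2 * (l2 * (r^-1 - 1))) / (gap_p / 2).
have S0 : 0 <= m2 * (1 - r) + C2 * (l2 * (r^-1 - 1)).
  exact: addr_ge0 (ltW (mulr_gt0 _ _)) (mulr_ge0 _ (ltW (mulr_gt0 _ _))).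
have C10 : 0 <= C1 by apply: divr_ge0 => //; exact: ltW.
exists (1 + C2 + C1 * (1 + B + M)); split.
  by rewrite !addr_ge0// mulr_ge0// !addr_ge0.
move=> n k z /andP[z0 zn].
pose h y := r ^+ n * monomial r^-1 r^-1 y
  + (C2 * (r ^+ n * monomial 1 r^-1 y) + C1 * (p ^+ n * corrector B M y)).
have cor0 y : quadrant y -> 0 <= corrector B M y.
  move=> qy; apply: addr_ge0; first by rewrite ltW// monomial_gt0.
  apply: addr_ge0; first by rewrite mulr_ge0// ltW// monomial_gt0.
  by rewrite mulNr -[X in X - _]mulr1 -mulrBr mulr_ge0// subr_ge0 kappa_le1.
have h2 y : quadrant y ->
    0 <= C2 * (r ^+ n * monomial 1 r^-1 y) + C1 * (p ^+ n * corrector B M y).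
  move=> qy; apply: addr_ge0; apply: mulr_ge0 => //.
    by rewrite ltW// mulr_gt0 ?exprn_gt0// monomial_gt0.
  by apply: mulr_ge0; [rewrite exprn_ge0// ltW | exact: cor0].
apply: (@le_trans _ _ (h (0, z))).
  apply: (@hit_prob_le quadrant (level n) (level 0) (triangle n)).
  - by move=> y Ty Ny _; exact: triangle_move.
  - move=> y /andP[qy _]; apply: addr_ge0; last exact: h2.
    by rewrite ltW// mulr_gt0 ?exprn_gt0// monomial_gt0.
  - by move=> y /andP[qy _] Ny; rewrite /h monomialE// lerDl h2.
  - move=> y /andP[qy sy] _ y0.
    have rn0 : r^-1 != 0 by rewrite gt_eqF.
    rewrite /h; have := sup _ qy y0; move: (corrector B M) => c.
    rewrite !(meanD, meanZ) !mean_quadrant_monomial ?oner_neq0//.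
    move: (c y) (mean _ c _) => {}c mc.
    have pn0 : 0 <= C1 * p ^+ n by rewrite mulr_ge0// exprn_ge0// ltW.
    rewrite invrK invr1 if_same !mulr1 monomial1l.
    case: eqP => y1.
      rewrite subr0 /= => /(ler_wpM2l pn0).
      have -> : (y.2 == 0) = false.
        by apply/negP => /eqP y2; move: y0; rewrite /level y1 y2.
      rewrite factor_r /monomial y1 expr0z mul1r.
      have -> : l1 / r + l2 / r + m1 * 1 + m2 * r = 1 + m1 * (1 - r).
        by move: factor_rr; lra.
      have e : C2 * gap_r = m1 * (1 - r) by rewrite /C2 divfK// gt_eqF.
      rewrite -e; move: (r^-1 ^ y.2) => q; lra.
    move=> /(ler_wpM2l pn0); rewrite mulrBr.
    case: eqP => y2; last first.
      rewrite factor_rr factor_r.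
      have a0 : 0 <= C2 * (r ^+ n * r^-1 ^ y.2 * gap_r).
        rewrite mulr_ge0//; apply: mulr_ge0; last exact: ltW.
        exact: exprVr_ge0.
      have b0 : 0 <= C1 * p ^+ n * (gap_p / 2 * p^-1 ^ y.1).
        apply: mulr_ge0 => //; apply: mulr_ge0; first exact: ltW.
        by rewrite exprz_ge0// ltW.
      move: a0 b0; lra.
    have [q1 _] := andP qy.
    rewrite /monomial y2 !expr0z.
    have -> : l1 / r + l2 / r + m1 * r + m2 * 1 = 1 + m2 * (1 - r).
      by move: factor_rr; lra.
    have -> : l1 + l2 / r + m1 + m2 * 1 = 1 + l2 * (r^-1 - 1).
      by move: sum1; lra.
    have y1n : y.1 <= n%:Z by move: sy; rewrite y2 addr0.
    have d1 := scale_le y1n.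
    have d2 : r ^+ n <= r ^+ n * r^-1 ^ y.1.
      apply: ler_peMr; first by rewrite exprn_ge0// ltW.
      by rewrite exprz_ge1// ltW.
    have e : C1 * (gap_p / 2) = m2 * (1 - r) + C2 * (l2 * (r^-1 - 1)).
      by rewrite /C1 divfK// gt_eqF.
    have f1 := ler_wpM2l S0 d1; rewrite -{2}e in f1.
    have g0 : 0 <= C2 * (l2 * (r^-1 - 1)).
      exact: (mulr_ge0 C20 (ltW (mulr_gt0 _ _))).
    have f2 := ler_wpM2l g0 d2.
    move: (r^-1 ^ y.1) (p^-1 ^ y.1) f1 f2 => u v; lra.
  - by rewrite /triangle /quadrant /= add0r z0.
rewrite /h /corrector !monomial1l !monomial1r /monomial /= !expr0z !mul1r.
(* At [x1 = 0] the corrector is at most [(1 + B + M) * t ^+ n], whence the term [(t * p) ^+ n]. *)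
have tn1 : 1 <= t ^+ n by rewrite exprn_ege1// ltW.
have tz : t ^ z <= t ^+ n by rewrite exprnP ler_weXz2l// ltW.
have pn0 : 0 <= C1 * p ^+ n by rewrite mulr_ge0// exprn_ge0// ltW.
have kz : 0 <= M * kappa ^ z by rewrite mulr_ge0// exprz_ge0// ltW.
have x1 : 1 + (B * t ^ z + (M + - M * kappa ^ z)) <= (1 + B + M) * t ^+ n.
  have := ler_wpM2l B0 tz; have := ler_wpM2l M0 tn1; move: kz; lra.
have y1 := ler_wpM2l pn0 x1.
have z1 : 0 <= (1 + C2) * (t * p) ^+ n.
  apply: mulr_ge0; first by rewrite addr_ge0.
  by rewrite exprn_ge0// ltW// mulr_gt0.
have w1 : 0 <= C1 * (1 + B + M) * (r ^+ n * r^-1 ^ z).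
  apply: mulr_ge0; last exact: exprVr_ge0.
  by rewrite mulr_ge0// !addr_ge0.
rewrite exprMn in z1 *; move: y1 z1 w1; lra.
Qed.

(** Without a constraint at [x1 = 0], [p^-1 ^ x1] is a strict supersolution everywhere and alone
    absorbs the excess of [r ^ (n - x1 - x2)] on [x2 = 0]. The term [p ^+ n] is weakened to
    [(t * p) ^+ n] to match the bound for [X]. *)
Lemma hit_prob_half_plane_axis : exists K, 0 <= K /\
  forall n k (z : int), 0 <= z <= n%:Z ->
    hit_prob half_plane (level n) pred0 k (0, z)
    <= K * (r ^+ n * r^-1 ^ z + (t * p) ^+ n).
Proof.
pose C := m2 * (1 - r) / gap_p.
have C0 : 0 <= C by apply/ltW/divr_gt0 => //; exact: mulr_gt0.
exists (1 + C); split; first by rewrite addr_ge0.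
move=> n k z /andP[z0 zn].
pose h y := r ^+ n * monomial r^-1 r^-1 y + C * (p ^+ n * monomial p^-1 1 y).
have h1 y : 0 <= r ^+ n * monomial r^-1 r^-1 y.
  by rewrite ltW// mulr_gt0 ?exprn_gt0// monomial_gt0.
have h2 y : 0 <= C * (p ^+ n * monomial p^-1 1 y).
  by rewrite mulr_ge0// ltW// mulr_gt0 ?exprn_gt0// monomial_gt0.
apply: (@le_trans _ _ (h (0, z))).
  apply: (@hit_prob_le half_plane (level n) pred0 (below n)).
  - by move=> y Ty Ny _; exact: below_move.
  - by move=> y _; exact: addr_ge0.
  - by move=> y _ Ny; rewrite /h monomialE// lerDl h2.
  - move=> y /andP[qy sy] _ _.
    have rn0 : r^-1 != 0 by rewrite gt_eqF.
    have n1 : p^-1 != 0 by rewrite gt_eqF.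
    rewrite /h !(meanD, meanZ) !mean_half_plane_monomial ?oner_neq0//.
    rewrite !invrK invr1 if_same !mulr1 factor_p monomial1r.
    have Y : 0 <= C * (p ^+ n * p^-1 ^ y.1 * gap_p).
      apply: mulr_ge0 => //; apply: mulr_ge0; last exact: ltW.
      exact: exprVr_ge0.
    case: eqP => y2; last by rewrite factor_rr; move: Y; lra.
    have -> : l1 / r + l2 / r + m1 * r + m2 * 1 = 1 + m2 * (1 - r).
      by move: factor_rr; lra.
    have y1n : y.1 <= n%:Z by move: sy; rewrite y2 addr0.
    have e : C * gap_p = m2 * (1 - r) by rewrite /C divfK// gt_eqF.
    rewrite /monomial y2 expr0z.
    have := ler_wpM2l (ltW (mulr_gt0 m2_gt0 r1_gt0)) (scale_le y1n).
    rewrite -{2}e; move: (r^-1 ^ y.1) (p^-1 ^ y.1) => u v; lra.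
  - by rewrite /below /half_plane /= add0r z0.
rewrite /h /monomial /= !expr0z exp1rz !mul1r mulr1.
have tn1 : 1 <= t ^+ n by rewrite exprn_ege1// ltW.
have pn0 : 0 <= p ^+ n by rewrite exprn_ge0// ltW.
have a1 := ler_wpM2l (mulr_ge0 C0 pn0) tn1.
have z1 : 0 <= (t * p) ^+ n by rewrite exprn_ge0// ltW// mulr_gt0.
have w1 : 0 <= C * (r ^+ n * r^-1 ^ z) by rewrite mulr_ge0// exprVr_ge0.
rewrite exprMn in z1 *; move: a1 z1 w1; lra.
Qed.

(** Induction on [k]: off [x1 = 0] both walks take the same step, so the difference is at most the
    mean of the right side, a supersolution there; on the axis the two probabilities are bounded
    separately. *)
Lemma hit_prob_coupling : exists K C, [/\ 0 <= K, 0 <= C &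
  forall n k y, triangle n y ->
    `|hit_prob quadrant (level n) (level 0) k y
      - hit_prob half_plane (level n) pred0 k y|
    <= K * (r ^+ n * r^-1 ^ y.2 + C * (r ^+ n * p^-1 ^ y.1) + (t * p) ^+ n)].
Proof.
have [K1 [K10 axis1]] := hit_prob_quadrant_axis.
have [K2 [K20 axis2]] := hit_prob_half_plane_axis.
(* The gap of [C * p^-1 ^ x1] cancels the excess of [r^-1 ^ x2] on [x2 = 0]. *)
pose C := l2 * (r^-1 - 1) / gap_p.
have C0 : 0 <= C by apply/ltW/divr_gt0 => //; exact: mulr_gt0.
exists (K1 + K2), C; split=> //; first exact: addr_ge0.
move=> n k y.
have n1 : p^-1 != 0 by rewrite gt_eqF.
have n2 : r^-1 != 0 by rewrite gt_eqF.
pose g y := (K1 + K2) * (r ^+ n * monomial 1 r^-1 y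
  + C * (r ^+ n * monomial p^-1 1 y) + (t * p) ^+ n).
suff : triangle n y -> `|hit_prob quadrant (level n) (level 0) k y
    - hit_prob half_plane (level n) pred0 k y| <= g y.
  by rewrite /g monomial1l monomial1r.
have rn0 : 0 <= r ^+ n by rewrite exprn_ge0// ltW.
have tp0 : 0 <= (t * p) ^+ n by rewrite exprn_ge0// ltW// mulr_gt0.
have g0 x : 0 <= g x.
  rewrite /g monomial1l monomial1r; apply: mulr_ge0; first exact: addr_ge0.
  apply: addr_ge0 => //; apply: addr_ge0; first exact: exprVr_ge0.
  by rewrite mulr_ge0// mulr_ge0// exprz_ge0// ltW.
have axis x : triangle n x -> x.1 = 0 -> forall j,
    `|hit_prob quadrant (level n) (level 0) j x
      - hit_prob half_plane (level n) pred0 j x| <= g x.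
  case: x => x1 x2 /andP[/andP[_ /= z0] /= sy] x0 j; rewrite {x1}x0 add0r in sy *.
  have zn : 0 <= x2 <= n%:Z by rewrite z0.
  have := hit_prob_ge0 quadrant (level n) (level 0) j (0, x2).
  have := hit_prob_ge0 half_plane (level n) pred0 j (0, x2).
  have := axis1 n j _ zn; have := axis2 n j _ zn.
  move: (hit_prob _ _ _ _ _) (hit_prob _ _ _ _ _) => b a h2 h1 b0 a0.
  have S0 : 0 <= r ^+ n * r^-1 ^ x2 + (t * p) ^+ n by rewrite addr_ge0// exprVr_ge0.
  have T0 : 0 <= (K1 + K2) * (C * (r ^+ n * monomial p^-1 1 (0, x2))).
    by rewrite mulr_ge0 ?addr_ge0// mulr_ge0// mulr_ge0// ltW// monomial_gt0.
  have := mulr_ge0 K10 S0; have := mulr_ge0 K20 S0.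
  rewrite /g monomial1l /= ler_norml => s1 s2.
  by apply/andP; split; move: h1 h2 a0 b0 T0 s1 s2; lra.
elim: k y => [|k IH] y Ty; have [y1|y1] := eqVneq y.1 0; try exact: axis.
  have [qy _] := andP Ty.
  have Z0 : level 0 y = false.
    by apply/negP => /(quadrant_level0 qy) yE; rewrite yE in y1.
  by rewrite /= Z0; case: ifP; rewrite subrr normr0.
have [qy sy] := andP Ty; have [q1 q2] := andP qy.
have y1p : 0 < y.1 by rewrite lt_def y1.
have Z0 : level 0 y = false.
  by apply/negP => /(quadrant_level0 qy) yE; rewrite yE in y1.
rewrite /= Z0; case: ifPn => [_|Ny]; first by rewrite subrr normr0.
apply: (@le_trans _ _ (mean quadrant g y)).
  rewrite /mean -!(move_quadrant_half_plane qy y1p) ?inE ?eqxx ?orbT//.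
  set a1 := hit_prob _ _ _ _ _; set a2 := hit_prob _ _ _ _ _.
  set a3 := hit_prob _ _ _ _ _; set a4 := hit_prob _ _ _ _ _.
  set b1 := hit_prob _ _ _ _ _; set b2 := hit_prob _ _ _ _ _.
  set b3 := hit_prob _ _ _ _ _; set b4 := hit_prob _ _ _ _ _.
  have -> : l1 * a1 + l2 * a2 + m1 * a3 + m2 * a4
      - (l1 * b1 + l2 * b2 + m1 * b3 + m2 * b4)
    = l1 * (a1 - b1) + l2 * (a2 - b2) + m1 * (a3 - b3) + m2 * (a4 - b4) by ring.
  have step v : v \in [:: (1, 0); (0, 1); (-1, 0); (0, -1)] ->
    `|hit_prob quadrant (level n) (level 0) k (move quadrant y v)
      - hit_prob half_plane (level n) pred0 k (move quadrant y v)|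
    <= g (move quadrant y v) by move=> vS; apply: IH; exact: triangle_move.
  have wstep c (u w : R) : 0 < c -> `|u| <= w -> `|c * u| <= c * w.
    by move=> c0 uw; rewrite normrM gtr0_norm// ler_pM2l.
  apply: le_trans (ler_normD _ _) _; apply: lerD; last first.
    by apply: wstep => //; apply: step; rewrite !inE eqxx ?orbT.
  apply: le_trans (ler_normD _ _) _; apply: lerD; last first.
    by apply: wstep => //; apply: step; rewrite !inE eqxx ?orbT.
  apply: le_trans (ler_normD _ _) _; apply: lerD.
    by apply: wstep => //; apply: step; rewrite !inE eqxx ?orbT.
  by apply: wstep => //; apply: step; rewrite !inE eqxx ?orbT.
rewrite /g !(meanD, meanZ) mean_cst !mean_quadrant_monomial ?oner_neq0//.
rewrite ler_wpM2l ?addr_ge0// lerD2r.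
rewrite (negbTE y1) invr1 !invrK if_same !mulr1 factor_p monomial1l monomial1r.
have P1 : 1 <= p^-1 ^ y.1 by rewrite exprz_ge1// ltW.
have Pg : 0 <= C * (r ^+ n * (p^-1 ^ y.1 * gap_p)).
  do 2!apply: mulr_ge0 => //; apply: mulr_ge0; last exact: ltW.
  exact: le_trans P1.
case: eqP => y2; last first.
  rewrite factor_r.
  have : 0 <= r ^+ n * r^-1 ^ y.2 * gap_r.
    by apply: mulr_ge0; [exact: exprVr_ge0 | exact: ltW].
  by move: Pg; lra.
have -> : l1 + l2 / r + m1 + m2 * 1 = 1 + l2 * (r^-1 - 1) by move: sum1; lra.
rewrite y2 expr0z.
have e : C * gap_p = l2 * (r^-1 - 1) by rewrite /C divfK// gt_eqF.
have c0 : 0 <= r ^+ n * (l2 * (r^-1 - 1)).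
  by rewrite mulr_ge0// ltW// mulr_gt0.
have := ler_wpM2l c0 P1; rewrite -e; move: (p^-1 ^ y.1) => u; lra.
Qed.

End Supersolutions.

End OneStep.

(** * Walks driven by finite words of increments *)

Lemma constrained_walkS (D : pred (int * int)) x v k :
  constrained_walk D x v k.+1 = constrained_walk D (move D x (v 0%N)) (fun i => v i.+1) k.
Proof. by elim: k => [//|k /= ->]. Qed.

(** Pathwise counterpart of [hit_prob]; reading a finite word makes hitting within [k] steps a
    cylinder event. *)
Fixpoint hits (D N Z : pred (int * int)) (x : int * int) (s : seq (int * int)) : bool :=
  N x || (~~ Z x && (if s is v :: s' then hits D N Z (move D x v) s' else false)).

Lemma hitsP (D N Z : pred (int * int)) (v : nat -> int * int) x m k :
  hits D N Z x [seq v i | i <- iota m k] <->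
  exists2 j, (j <= k)%N & N (constrained_walk D x (fun i => v (m + i)%N) j) /\
    forall l, (l < j)%N -> ~~ Z (constrained_walk D x (fun i => v (m + i)%N) l).
Proof.
elim: k x m => [|k IH] x m.
  rewrite /= andbF orbF; split=> [Nx|[[|//] _ [Nx _]]]; last exact: Nx.
  by exists 0%N.
have -> : hits D N Z x [seq v i | i <- iota m k.+1]
  = N x || (~~ Z x && hits D N Z (move D x (v m)) [seq v i | i <- iota m.+1 k]) by [].
have shift l : constrained_walk D x (fun i => v (m + i)%N) l.+1
    = constrained_walk D (move D x (v m)) (fun i => v (m.+1 + i)%N) l.
  rewrite constrained_walkS addn0; congr constrained_walk.
  by apply/funext => i; rewrite addSnnS.
split=> [/orP[Nx|/andP[Zx /IH[j jk [Nj Zj]]]]|[[|j] jk [Nj Zj]]].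
- by exists 0%N.
- exists j.+1 => //; split; first by rewrite shift.
  by case=> [_ //|l lj]; rewrite shift; exact: Zj.
- by rewrite [N x]Nj.
- apply/orP; right; rewrite (Zj 0%N)//=; apply/IH; exists j => //.
  by rewrite -shift; split=> // l lj; rewrite -shift; exact: Zj.
Qed.

(** * Hitting times as infima in the extended reals *)

Section HittingTimes.
Variable R : realType.

(** Times are integers: avoiding [B] up to time [k] included puts its hitting time at [k + 1] or
    later, possibly at infinity. *)
Lemma hitting_time_lt (A B : set (int * int)) (Z : nat -> int * int) :
  (hitting_time R A Z < hitting_time R B Z)%E <->
  exists2 k, A (Z k) & forall j, (j <= k)%N -> ~ B (Z j).
Proof.
split=> [/ereal_inf_lt[_ [k Ak <-]] kB|[k Ak kB]].
  exists k => // j jk Bj; move: kB; apply/negP; rewrite -leNgt.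
  apply: (@le_trans _ _ (j%:R%:E)); last by rewrite lee_fin ler_nat.
  by apply: ereal_inf_lbound; exists j.
apply: (@le_lt_trans _ _ (k%:R%:E)).
  by apply: ereal_inf_lbound; exists k.
apply: (@lt_le_trans _ _ (k.+1%:R%:E)); first by rewrite lte_fin ltr_nat.
apply: le_ereal_inf_tmp => _ [j Bj <-]; rewrite lee_fin ler_nat ltnNge.
by apply/negP => jk; exact: (kB j).
Qed.

Lemma hitting_time_lty (A : set (int * int)) (Z : nat -> int * int) :
  (hitting_time R A Z < +oo)%E <-> exists k, A (Z k).
Proof.
split=> [/ereal_inf_lt[_ [k Ak _] _]|[k Ak]]; first by exists k.
apply: (@le_lt_trans _ _ (k%:R%:E)); last exact: ltry.
by apply: ereal_inf_lbound; exists k.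
Qed.

End HittingTimes.

(** * Probabilities of cylinder events *)

Section Cylinders.
Context d (T : measurableType d) (R : realType) (P : probability T R).
Variables (l1 l2 m1 m2 : R) (I : nat -> T -> int * int).
Hypothesis sum1 : l1 + l2 + m1 + m2 = 1.
Hypothesis hI : iid_steps P l1 l2 m1 m2 I.

Let word (w : T) (m k : nat) := [seq I i w | i <- iota m k].

(** Any [Q] is allowed because letters range over a countable type; the induction splits on the
    first letter. *)
Lemma measurable_word (Q : seq (int * int) -> Prop) m k :
  measurable [set w | Q (word w m k)].
Proof.
have [mI _ _] := hI.
elim: k m Q => [|k IH] m Q.
  have [q|q] := pselect (Q [::]).
    by rewrite (_ : [set w | _] = setT)//; apply/seteqP; split.
  by rewrite (_ : [set w | _] = set0)//; apply/seteqP; split.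
rewrite (_ : [set w | _] = \bigcup_v
    (I m @^-1` [set v] `&` [set w | (Q \o cons v) (word w m.+1 k)])).
  apply: countable_bigcupT_measurable => [|v]; first exact: countableP.
  by apply: measurableI; [exact: mI | exact: IH].
apply/seteqP; split=> w /=; first by exists (I m w).
by move=> [v _ [<-]].
Qed.

Let step k (v : int * int) : set T := I k @^-1` [set v].

Lemma measure_step_split k (E : set T) : measurable E ->
  P E = (P (E `&` step k (1, 0)%R) + P (E `&` step k (0, 1)%R)
    + P (E `&` step k (-1, 0)%R) + P (E `&` step k (0, -1)%R)
    + P (E `\` step k (1, 0)%R `\` step k (0, 1)%R
        `\` step k (-1, 0)%R `\` step k (0, -1)%R))%E.
Proof.
move=> mE; have [mI _ _] := hI.
have m_ v : measurable (step k v) by exact: mI.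
have split1 F v : measurable F ->
    P F = (P (F `&` step k v) + P (F `\` step k v))%E.
  by move=> mF; rewrite addeC; apply: measureDI.
have diff F u v : u <> v ->
    (F `\` step k u) `&` step k v = F `&` step k v.
  move=> uv; apply/seteqP; split=> w /=; first by move=> [[]].
  by move=> [Fw vw]; split=> //; split=> // uw; apply: uv; rewrite -uw -vw.
rewrite {1}(split1 _ (1, 0) mE) -!addeA; congr (_ + _)%E.
rewrite {1}(split1 _ (0, 1)); last exact: measurableD.
rewrite diff//; congr (_ + _)%E.
rewrite {1}(split1 _ (-1, 0)); last by do 2!apply: measurableD => //.
rewrite !diff//; congr (_ + _)%E.
rewrite {1}(split1 _ (0, -1)); last by do 3!apply: measurableD => //.
by rewrite !diff.
Qed.

(** The step law fixes four masses; all other values together are null because these masses add up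
    to 1. *)
Lemma measure_step_sum k (E : set T) : measurable E ->
  P E = (P (E `&` step k (1, 0)%R) + P (E `&` step k (0, 1)%R)
    + P (E `&` step k (-1, 0)%R) + P (E `&` step k (0, -1)%R))%E.
Proof.
move=> mE; have [mI _ /(_ k)[p1 p2 p3 p4]] := hI.
have m_ v : measurable (step k v) by exact: mI.
rewrite (measure_step_split k mE) -[RHS]adde0; congr (_ + _)%E.
apply/eqP; rewrite eq_le measure_ge0 andbT.
pose rest F := F `\` step k (1, 0)%R `\` step k (0, 1)%R
  `\` step k (-1, 0)%R `\` step k (0, -1)%R.
have mrest F : measurable F -> measurable (rest F).
  by move=> mF; do 4!apply: measurableD => //.
apply: (@le_trans _ _ (P (rest setT))).
  apply: le_measure; rewrite ?inE; [exact: mrest | exact: mrest |].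
  by rewrite /rest => w /= [[[[]]]].
have := measure_step_split k (@measurableT _ T).
rewrite probability_setT !setTI p1 p2 p3 p4 -!EFinD sum1.
rewrite -/(rest setT); move: (rest setT) (mrest _ measurableT) => F mF.
have : P F \is a fin_num by exact: fin_num_measure.
case: (P F) => [q| |]// _; rewrite -EFinD => -[q1].
by rewrite lee_fin; lra.
Qed.

Let wordS w m : word w 0 m.+1 = word w 0 m ++ [:: I m w].
Proof. by rewrite /word -[X in iota 0 X]addn1 iotaD map_cat. Qed.

(** The last branch is also the default; only for words in [unit_steps] is this the step law. *)
Let weight (v : int * int) : R :=
  if v == (1, 0) then l1 else if v == (0, 1) then l2
  else if v == (-1, 0) then m1 else m2.

Let unit_steps : seq (int * int) := [:: (1, 0); (0, 1); (-1, 0); (0, -1)].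

Lemma measure_prefix (pre : seq (int * int)) : {subset pre <= unit_steps} ->
  P [set w | word w 0 (size pre) = pre] = (\prod_(v <- pre) weight v)%:E.
Proof.
move=> preS; have [mI indep law] := hI.
have -> : [set w | word w 0 (size pre) = pre]
    = \bigcap_(k in [set` iota 0 (size pre)]) (I k @^-1` [set nth 0 pre k]).
  apply/seteqP; split=> w /= h.
    move=> k /=; rewrite mem_iota /= => kp.
    by rewrite -[in RHS]h (nth_map 0%N) ?size_iota// nth_iota.
  apply: (@eq_from_nth _ 0); rewrite size_map size_iota// => k kp.
  rewrite (nth_map 0%N) ?size_iota// nth_iota//; apply: h.
  by rewrite /= mem_iota.
rewrite (indep _ (fun k => [set nth 0 pre k])) ?iota_uniq//.
rewrite -{3}(mkseq_nth 0 pre) /mkseq big_map -prodEFin.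
rewrite !big_seq; apply: eq_bigr => k; rewrite mem_iota /= => kp.
have [p1 p2 p3 p4] := law k; have := preS _ (mem_nth 0 kp).
by rewrite !inE => /orP[/eqP->|/orP[/eqP->|/orP[/eqP->|/eqP->]]].
Qed.

(* The prefix makes the first-step decomposition an instance of the same
   statement, so the shifted sequence needs no separate treatment. *)
Lemma measure_prefix_hits (D N Z : pred (int * int)) k pre x :
  {subset pre <= unit_steps} ->
  P ([set w | word w 0 (size pre) = pre]
      `&` [set w | hits D N Z x (word w (size pre) k)])
  = (\prod_(v <- pre) weight v * hit_prob l1 l2 m1 m2 D N Z k x)%:E.
Proof.
have sT : [set _ : T | true] = setT by apply/seteqP.
have sF : [set _ : T | false] = set0 by apply/seteqP; split.
elim: k pre x => [|k IH] pre x preS.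
  rewrite /= andbF orbF; case: (N x).
    by rewrite sT setIT mulr1 measure_prefix.
  by rewrite if_same sF setI0 measure0 mulr0.
rewrite /=; have [Nx|Nx] /= := boolP (N x).
  by rewrite sT setIT mulr1 measure_prefix.
have [Zx|Zx] /= := boolP (Z x).
  by rewrite sF setI0 measure0 mulr0.
set E := _ `&` _.
have mE : measurable E.
  apply: measurableI; first exact: (measurable_word (fun s => s = pre)).
  exact: (measurable_word (fun s =>
    if s is v :: s' then hits D N Z (move D x v) s' : Prop else False) (size pre) k.+1).
have step_eq v : v \in unit_steps ->
    P (E `&` step (size pre) v)
    = (\prod_(v <- pre) weight v
       * (weight v * hit_prob l1 l2 m1 m2 D N Z k (move D x v)))%:E.
  move=> vS; have : {subset rcons pre v <= unit_steps}.
    by move=> u; rewrite mem_rcons inE => /orP[/eqP->|/preS].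
  move=> /(IH _ (move D x v)); rewrite -cats1 big_cat /= big_seq1 mulrA.
  rewrite size_cat addn1 => <-.
  congr (P _); apply/seteqP; split=> w /=.
    move=> [[h1 h2] h3]; rewrite wordS h1 h3; split=> //.
    by move: h2 => /=; rewrite h3.
  rewrite wordS => -[/eqP]; rewrite eqseq_cat ?size_map ?size_iota//.
  move=> /andP[/eqP h0 /eqP[h1]] h2; split; last exact: h1.
  by split=> //=; rewrite h1.
rewrite (measure_step_sum (size pre) mE) !step_eq// ?inE ?eqxx ?orbT// -!EFinD.
by congr (_%:E); rewrite /mean /weight /=; ring.
Qed.

(** * From finite horizons to the hitting probabilities of the walks *)

Lemma measure_hits (D N Z : pred (int * int)) k x :
  P [set w | hits D N Z x (word w 0 k)] = (hit_prob l1 l2 m1 m2 D N Z k x)%:E.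
Proof.
have := @measure_prefix_hits D N Z k [::] x.
rewrite big_nil mul1r /= => <-//; congr (P _).
by apply/seteqP; split=> w /=; [split|case].
Qed.

(** The events of hitting within [k] steps increase to [E], so the measure is continuous along them
    from below. *)
Lemma hit_prob_cvg (D N Z : pred (int * int)) x
    (E := [set w | exists2 j, N (constrained_walk D x (I^~ w) j) &
      forall l, (l < j)%N -> ~~ Z (constrained_walk D x (I^~ w) l)]) :
  hit_prob l1 l2 m1 m2 D N Z k x @[k --> \oo] --> fine (P E) /\
  forall k, hit_prob l1 l2 m1 m2 D N Z k x <= fine (P E).
Proof.
pose F k := [set w | hits D N Z x (word w 0 k)].
have mF k : measurable (F k) by exact: (measurable_word (hits D N Z x)).
have FE : \bigcup_k F k = E.
  apply/seteqP; split=> w /=.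
    by move=> [k _ /hitsP[j _ [Nj Zj]]]; exists j.
  by move=> [j Nj Zj]; exists j => //; apply/hitsP; exists j.
have mE : measurable E by rewrite -FE; exact: bigcup_measurable.
have PE : P E \is a fin_num by exact: fin_num_measure.
split=> [|k].
  have : (P \o F) k @[k --> \oo] --> (fine (P E))%:E.
    rewrite fineK// -FE; apply: nondecreasing_cvg_mu => //; first by rewrite FE.
    move=> i j ij; apply/subsetPset => w /= /hitsP[l li [Nl Zl]].
    by apply/hitsP; exists l => //; exact: leq_trans ij.
  move=> /fine_cvg; apply: cvg_trans; apply: near_eq_cvg.
  by apply: nearW => k /=; rewrite measure_hits.
rewrite -lee_fin fineK// -measure_hits; apply: le_measure; rewrite ?inE//.
  exact: mF.
by rewrite -FE => w Fw; exists k.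
Qed.

(** The strict inequality of times forbids level 0 also at the hitting time itself, the right side
    only before it; they agree because levels [n] and 0 are disjoint for [n > 0]. *)
Lemma prob_XE n x : (0 < n)%N -> prob_X P I n x =
  fine (P [set w | exists2 j, level n (constrained_walk quadrant x (I^~ w) j) &
    forall l, (l < j)%N -> ~~ level 0 (constrained_walk quadrant x (I^~ w) l)]).
Proof.
move=> n0; rewrite /prob_X; congr (fine (P _)); apply/seteqP; split=> w /=.
  move=> /hitting_time_lt[k /= kn k0]; exists k; first exact/eqP.
  by move=> l lk; apply/negP => /eqP; apply: k0; exact: ltnW.
move=> [j /eqP jn j0]; apply/hitting_time_lt; exists j => //= l.
rewrite leq_eqVlt => /orP[/eqP->|/j0/negP l0 l0']; last exact/l0/eqP.
by rewrite /walkX jn => -[nE]; rewrite nE in n0.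
Qed.

Lemma prob_XbarE n x : prob_Xbar P I n x =
  fine (P [set w | exists2 j, level n (constrained_walk half_plane x (I^~ w) j) &
    forall l, (l < j)%N -> ~~ pred0 (constrained_walk half_plane x (I^~ w) l)]).
Proof.
rewrite /prob_Xbar; congr (fine (P _)); apply/seteqP; split=> w /=.
  move=> /hitting_time_lty[k]; rewrite walkXbarE => kn.
  by exists k => //; exact/eqP.
move=> [j /eqP jn _]; apply/hitting_time_lty; exists j.
by rewrite walkXbarE.
Qed.

Lemma prob_YE n x : prob_Y P I (T_map n x) = prob_Xbar P I n x.
Proof.
rewrite /prob_Y /prob_Xbar; congr (fine (P _)).
apply/seteqP; split=> w /= /hitting_time_lty[k /= h];
  apply/hitting_time_lty; exists k => /=;
  move: h; rewrite /walkXbar /T_map /=; move: (walkY _ _ _) => -[a b] /=; lia.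
Qed.

End Cylinders.

(** * Exponential decay, scaled starting points and limits of differences *)

Lemma geometric_lt_expR (R : realType) (A q : R) (L : nat) :
  0 <= A -> 0 < q < 1 -> (0 < L)%N ->
  exists c N, 0 < c /\ forall n m : nat, (N < n)%N -> (n <= L * m)%N ->
    A * q ^+ m < expR (- c * n%:R).
Proof.
move=> A0 q01 L0; have [q0 q1] := andP q01.
have L0' : 0 < L%:R :> R by rewrite ltr0n.
(* From [n <= L * m], [q ^+ m] is at most [expR (- (2 * (c * n)))]; half of this rate is given up to
   absorb [A] once [n > A / c]. *)
pose c := - ln q / (2 * L%:R).
have c0 : 0 < c by rewrite divr_gt0 ?mulr_gt0// oppr_gt0 ln_lt0.
exists c, (Num.bound (A / c)); split=> // n m Nn nm.
have Acn : A < c * n%:R.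
  rewrite mulrC -ltr_pdivrMr//; apply: lt_trans (archi_boundP _) _.
    by rewrite divr_ge0// ltW.
  by rewrite ltr_nat.
have Ae : A < expR (c * n%:R).
  by apply: lt_le_trans Acn _; apply: le_trans (expR_ge1Dx _); rewrite lerDr.
have qe : q ^+ m <= expR (- (2 * (c * n%:R))).
  rewrite -[q]lnK ?posrE// -expRM_natl ler_expR.
  have -> : m%:R * ln q = - (2 * (c * (L * m)%:R)).
    by rewrite natrM /c; field; rewrite gt_eqF.
  by rewrite lerN2 ler_pM2l// ler_pM2l// ler_nat.
apply: (@le_lt_trans _ _ (A * expR (- (2 * (c * n%:R))))); first exact: ler_wpM2l.
have -> : - c * n%:R = c * n%:R + - (2 * (c * n%:R)) by ring.
by rewrite expRD ltr_pM2r// expR_gt0.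
Qed.

Lemma scaled_start_bound (R : realType) (x : R * R) :
  0 < x.1 -> 0 <= x.2 -> x.1 + x.2 < 1 ->
  exists2 L, (0 < L)%N & forall n, (L <= n)%N -> exists m : nat,
    [/\ (scaled_start x n).1 = m%:Z, (n <= L * m)%N, (0 < m <= n)%N &
      triangle n (scaled_start x n)].
Proof.
(* As [x.1 * L >= 2], rounding down gives [2 * n <= L * (m + 1)], and [L <= n] then leaves
   [n <= L * m]. *)
move=> x1 x2 xs; pose L := (Num.bound (2 / x.1)).+1.
have x1L : 2 <= x.1 * L%:R.
  rewrite mulrC -ler_pdivrMr//; apply: le_trans (ltW (archi_boundP _)) _.
    by rewrite divr_ge0// ltW.
  by rewrite ler_nat.
exists L => // n Ln.
have L0 : 0 < L%:R :> R by rewrite ltr0n.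
have n0 : 0 <= n%:R :> R by [].
have Ln' : L%:R <= n%:R :> R by rewrite ler_nat.
rewrite /scaled_start /triangle /quadrant /=.
set a := Num.floor (x.1 * n%:R); set b := Num.floor (x.2 * n%:R).
have a0 : 0 <= a by rewrite floor_ge0 mulr_ge0// ltW.
have b0 : 0 <= b by rewrite floor_ge0 mulr_ge0.
have la : a%:~R <= x.1 * n%:R by exact: floor_le.
have lb : b%:~R <= x.2 * n%:R by exact: floor_le.
have ga : x.1 * n%:R < a%:~R + 1 by have := floorD1_gt (x.1 * n%:R); rewrite intrD.
have ab : a + b <= n%:Z.
  rewrite -(ler_int R) intrD -pmulrn; apply: le_trans (lerD la lb) _.
  by rewrite -mulrDl ler_piMl// ltW.
case: a a0 la ga ab => // m _ la ga ab.
exists m.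
have nLm : n%:R <= (L * m)%:R :> R.
  have : 2 * n%:R <= x.1 * n%:R * L%:R by rewrite mulrAC ler_wpM2r.
  have : x.1 * n%:R * L%:R <= (m%:R + 1) * L%:R by rewrite ler_pM2r// ltW// ga.
  rewrite natrM; lra.
rewrite ler_nat in nLm; split=> //; last by rewrite b0 ab.
apply/andP; split; last by move: ab b0; lia.
rewrite lt0n; apply/eqP => m0; move: nLm; rewrite m0 muln0 leqn0 => /eqP nE.
by rewrite nE in Ln.
Qed.

Lemma cvg_dist_le (R : realType) (u v : nat -> R) (a b G : R) :
  u k @[k --> \oo] --> a -> v k @[k --> \oo] --> b ->
  (forall k, `|u k - v k| <= G) -> `|a - b| <= G.
Proof.
move=> ua vb uvG.
have uv : `|u k - v k| @[k --> \oo] --> `|a - b| by apply: cvg_norm; exact: cvgB.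
rewrite -(cvg_lim _ uv)//; apply: limr_le; first by apply/cvg_ex; eexists; exact: uv.
by apply: nearW => k; exact: uvG.
Qed.

(** * Relative error of the approximation *)

Section Ratio.
Context d (T : measurableType d) (R : realType) (P : probability T R).
Variables (l1 l2 m1 m2 : R) (I : nat -> T -> int * int).
Hypothesis l1_gt0 : 0 < l1.
Hypothesis l2_gt0 : 0 < l2.
Hypothesis m1_gt0 : 0 < m1.
Hypothesis m2_gt0 : 0 < m2.
Hypothesis sum1 : l1 + l2 + m1 + m2 = 1.
Hypothesis hI : iid_steps P l1 l2 m1 m2 I.

Lemma prob_diff_le n y (G : R) : (0 < n)%N ->
  (forall k, `|hit_prob l1 l2 m1 m2 quadrant (level n) (level 0) k y
      - hit_prob l1 l2 m1 m2 half_plane (level n) pred0 k y| <= G) ->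
  `|prob_X P I n y - prob_Xbar P I n y| <= G.
Proof.
move=> n0 uvG; rewrite prob_XE// prob_XbarE.
have [cu _] := hit_prob_cvg sum1 hI quadrant (level n) (level 0) y.
have [cv _] := hit_prob_cvg sum1 hI half_plane (level n) pred0 y.
exact: cvg_dist_le cu cv uvG.
Qed.

(** The subsolutions are the monomials with [(c, b)] equal to [(r, r^-1)] and [(rho, 1)]; absorbing
    their values at the origin costs the factor [1 - rho]. *)
Lemma prob_X_lower n (m : nat) y (r rho : R) :
  0 < r -> r <= rho -> rho < 1 -> l1 = rho * m1 -> l1 + l2 = r * (m1 + m2) ->
  (0 < m)%N -> y.1 = m%:Z -> (0 < n)%N -> triangle n y ->
  (rho ^+ n * rho^-1 ^+ m) * (1 - rho) <= prob_X P I n y /\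
  (r ^+ n * monomial r^-1 r^-1 y) * (1 - rho) <= prob_X P I n y.
Proof.
move=> r0 rrho rho1 l1E rE m0 y1 n0 Ty.
have rho0 : 0 < rho by exact: lt_le_trans rrho.
have r1 : r < 1 by exact: le_lt_trans rho1.
have bound k : hit_prob l1 l2 m1 m2 quadrant (level n) (level 0) k y <= prob_X P I n y.
  by rewrite prob_XE//; case: (hit_prob_cvg sum1 hI quadrant (level n) (level 0) y).
have rr : r^-1 * r = 1 by rewrite mulVf ?gt_eqF.
have pp : rho^-1 * rho = 1 by rewrite mulVf ?gt_eqF.
have h1 : r ^+ n * monomial r^-1 r^-1 y <= prob_X P I n y + r ^+ n.
  apply: (hit_prob_monomial_ge l1_gt0 l2_gt0 m1_gt0 m2_gt0 sum1) => //.
  - by rewrite invf_ge1// ltW.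
  - by rewrite rr.
  - rewrite invrK; move: r^-1 rr => q qr.
    have e : (l1 + l2) * q = m1 + m2 by rewrite rE mulrAC [r * q]mulrC qr mul1r.
    by move: sum1 rE e; lra.
have h2 : rho ^+ n * monomial rho^-1 1 y <= prob_X P I n y + rho ^+ n.
  apply: (hit_prob_monomial_ge l1_gt0 l2_gt0 m1_gt0 m2_gt0 sum1) => //.
  - by rewrite mul1r ltW.
  - rewrite invr1 !mulr1; move: rho^-1 pp => q qp.
    have e : l1 * q = m1 by rewrite l1E mulrAC [rho * q]mulrC qp mul1r.
    by rewrite e; move: sum1 l1E; lra.
rewrite monomial1r y1 -exprnP in h2.
set Q := rho ^+ n * rho^-1 ^+ m in h2 *; set X := prob_X P I n y in h1 h2 *.
have Q0 : 0 < Q by rewrite mulr_gt0 ?exprn_gt0 ?invr_gt0.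
(* Here [m > 0] enters: the error is [rho ^+ m * Q]. *)
have rhoQ : rho ^+ n <= rho * Q.
  have -> : rho ^+ n = rho ^+ m * Q.
    by rewrite /Q mulrCA -exprMn mulfV ?gt_eqF// expr1n mulr1.
  rewrite ler_wpM2r ?(ltW Q0)// -(prednK m0) exprS.
  by rewrite ler_piMr ?exprn_ile1// ltW.
have rn : r ^+ n <= rho ^+ n by apply: lerXn2r; rewrite ?nnegrE// ltW.
have XQ : Q * (1 - rho) <= X by lra.
split=> //; set S := r ^+ n * _ in h1 *.
(* The error of this bound is controlled by [X] through the first one, [Q * (1 - rho) <= X]. *)
have SX : S <= X + rho * Q by lra.
have := ler_wpM2r (ltW (_ : 0 < 1 - rho)) SX; rewrite subr_gt0 => /(_ rho1).
have := ler_wpM2l (ltW rho0) XQ; lra.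
Qed.

Lemma prob_ratio_le (r rho : R) (L : nat) :
  0 < r -> r < rho -> rho < 1 -> l1 = rho * m1 -> l1 + l2 = r * (m1 + m2) ->
  l2 < r * m2 -> (0 < L)%N ->
  exists A q, [/\ 0 <= A, 0 < q < 1 & forall n (m : nat) y,
    (0 < n)%N -> triangle n y -> y.1 = m%:Z -> (0 < m <= n)%N -> (n <= L * m)%N ->
    0 < prob_X P I n y /\
    `|prob_X P I n y - prob_Xbar P I n y| / prob_X P I n y <= A * q ^+ m].
Proof.
move=> r0 rrho rho1 l1E rE l2E L0.
have rho0 : 0 < rho by exact: lt_trans rrho.
have L0' : 0 < (2 * L)%:R :> R by rewrite ltr0n muln_gt0.
(* Chosen so that [t ^+ (2 * L) * rho] is the square root of [rho], hence below 1. *)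
pose t := expR (- ln rho / (2 * (2 * L)%:R)).
have lnr : 0 < - ln rho by rewrite oppr_gt0 ln_lt0// rho0 rho1.
have t1 : 1 < t by rewrite expR_gt1 divr_gt0// mulr_gt0.
have t0 : 0 < t by exact: lt_trans t1.
have tL : t ^+ (2 * L) * rho < 1.
  rewrite -expRM_natl -{2}[rho]lnK ?posrE// -expRD expR_lt1.
  have -> : (2 * L)%:R * (- ln rho / (2 * (2 * L)%:R)) = - ln rho / 2.
    by move: (2 * L)%:R L0' => a a0; field; rewrite gt_eqF.
  by lra.
have trho : t * rho < 1.
  apply: le_lt_trans tL; rewrite ler_pM2r//.
  by rewrite -[leLHS]expr1 ler_weXn2l ?(ltW t1)// muln_gt0.
have rt : r <= t * rho by rewrite (le_trans (ltW rrho))// ler_peMl// ltW.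
have l1t : l1 < t * rho * m1 by rewrite -mulrA -l1E ltr_pMl.
have l2t : t * l2 < m2.
  rewrite (@lt_le_trans _ _ (t * (rho * m2)))//.
    by rewrite ltr_pM2l// (lt_trans l2E)// ltr_pM2r.
  by rewrite mulrA ler_piMl// ltW.
have r1 : r < 1 by exact: lt_trans rho1.
have [K [C [K0 C0 coupling]]] := hit_prob_coupling l1_gt0 l2_gt0 m1_gt0 m2_gt0
  sum1 r0 r1 rE l2E rt trho l1t t1 l2t.
(* One rate per term of the coupling bound, taken with [p = t * rho] and compared with the lower
   bounds: [r] for [r ^ (n - y2)], [r / rho] for [r ^+ n * (t * rho)^-1 ^+ m], and the last, through
   [n <= L * m], for [(t * (t * rho)) ^+ n]. *)
pose q := Num.max r (Num.max (r / rho) (t ^+ (2 * L) * rho)).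
have q1 : q < 1 by rewrite !gt_max r1 tL ltr_pdivrMr// mul1r rrho.
have rq : r <= q by rewrite le_max lexx.
have q0 : 0 < q by exact: lt_le_trans rq.
have rrq : r / rho <= q by rewrite !le_max lexx orbT.
have tq : t ^+ (2 * L) * rho <= q by rewrite !le_max lexx !orbT.
exists (K * (2 + C) / (1 - rho)), q; split.
- apply: divr_ge0; last by rewrite subr_ge0 ltW.
  by rewrite mulr_ge0// addr_ge0.
- by rewrite q0.
move=> n m y n0 Ty y1 /andP[m0 mn] nLm.
have [lowQ lowS] := prob_X_lower r0 (ltW rrho) rho1 l1E rE m0 y1 n0 Ty.
have rho1' : 0 < 1 - rho by rewrite subr_gt0.
set X := prob_X P I n y in lowQ lowS *.
set Q := rho ^+ n * rho^-1 ^+ m in lowQ.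
have Q0 : 0 < Q by rewrite mulr_gt0 ?exprn_gt0 ?invr_gt0.
have X0 : 0 < X by apply: lt_le_trans lowQ; rewrite mulr_gt0.
split=> //.
have /(prob_diff_le n0) := fun k => coupling n k y Ty.
rewrite -/X ler_pdivrMr// => /le_trans; apply.
rewrite -!mulrA ler_wpM2l// y1 -!exprnP.
have qm0 : 0 <= q ^+ m by rewrite exprn_ge0// ltW.
pose Y := X / (1 - rho).
have QY : Q <= Y by rewrite ler_pdivlMr.
have Y0 : 0 < Y by exact: lt_le_trans QY.
have SY : r ^+ n * monomial r^-1 r^-1 y <= Y by rewrite ler_pdivlMr.
have le_q u : 0 <= u -> u <= q -> u ^+ m <= q ^+ m.
  by move=> u0 uq; rewrite lerXn2r// nnegrE// ltW.
have b1 : r ^+ n * r^-1 ^ y.2 <= q ^+ m * Y.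
  have -> : r ^+ n * r^-1 ^ y.2 = r ^+ m * (r ^+ n * monomial r^-1 r^-1 y).
    rewrite /monomial y1 -exprnP mulrCA [r ^+ m * _]mulrA -exprMn mulfV ?gt_eqF//.
    by rewrite expr1n mul1r.
  rewrite ler_pM ?exprn_ge0 ?(ltW r0)//; last by rewrite le_q// ltW.
  by rewrite mulr_ge0 ?exprn_ge0 ?ltW// monomial_gt0// invr_gt0.
have b2 : r ^+ n * (t * rho)^-1 ^+ m <= q ^+ m * Y.
  apply: (@le_trans _ _ ((r / rho) ^+ m * Q)); last first.
    have rrho0 : 0 <= r / rho by rewrite divr_ge0// ltW.
    by apply: ler_pM => //; [rewrite exprn_ge0 | exact: ltW | exact: le_q].
  apply: (@le_trans _ _ ((r / rho) ^+ n * Q)).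
    have -> : (r / rho) ^+ n * Q = r ^+ n * rho^-1 ^+ m.
      by rewrite /Q mulrA -exprMn divfK ?gt_eqF.
    have trho0 : 0 < t * rho by rewrite mulr_gt0.
    apply: ler_wpM2l; first by rewrite exprn_ge0// ltW.
    apply: lerXn2r; rewrite ?nnegrE ?invr_ge0 ?(ltW trho0) ?(ltW rho0)//.
    by rewrite lef_pV2 ?posrE// ler_peMl// ltW.
  rewrite ler_wpM2r ?(ltW Q0)//; apply: ler_wiXn2l => //.
    by rewrite divr_ge0// ltW.
  by rewrite ler_pdivrMr// mul1r ltW.
have b3 : (t * (t * rho)) ^+ n <= q ^+ m * Y.
  have -> : (t * (t * rho)) ^+ n = t ^+ (2 * n) * rho ^+ m * Q.
    rewrite /Q -mulrA [rho ^+ m * _]mulrCA -[rho ^+ m * _]exprMn mulfV ?gt_eqF//.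
    by rewrite expr1n mulr1 mulrA exprMn -expr2 -exprM.
  apply: ler_pM => //; first (by rewrite mulr_ge0// exprn_ge0// ltW); first exact: ltW.
  apply: (@le_trans _ _ ((t ^+ (2 * L) * rho) ^+ m)); last first.
    apply: le_q => //; apply: mulr_ge0; last exact: ltW.
    by rewrite exprn_ge0// ltW.
  rewrite exprMn -exprM ler_wpM2r ?exprn_ge0 ?(ltW rho0)//.
  by rewrite ler_weXn2l ?(ltW t1)// -mulnA leq_pmul2l.
have b2' := ler_wpM2l C0 b2.
have -> : (2 + C) * ((1 - rho)^-1 * (q ^+ m * X)) = (2 + C) * (q ^+ m * Y).
  by rewrite /Y; congr (_ * _); rewrite mulrCA [X / _]mulrC.
lra.
Qed.

End Ratio.

(** * Strict ordering of the rates and the exponential bound *)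

Theorem theorem6p1 (R : realType) (lambda1 lambda2 mu1 mu2 rho1 rho2 r : R)
    (hlambda1 : 0 < lambda1) (hlambda2 : 0 < lambda2)
    (hmu1 : 0 < mu1) (hmu2 : 0 < mu2)
    (hsum : lambda1 + lambda2 + mu1 + mu2 = 1)
    (hrho1 : rho1 = lambda1 / mu1) (hrho2 : rho2 = lambda2 / mu2)
    (hr : r = (lambda1 + lambda2) / (mu1 + mu2))
    (hrho1_lt1 : rho1 < 1) (hrho2_lt1 : rho2 < 1)
    (hrho2_r : rho2 <= r) (hr_rho1 : r <= rho1) (hrho_neq : rho1 <> rho2)
    (hr_rho2 : r ^+ 2 / rho2 < 1)
    (d : measure_display) (T : measurableType d) (P : probability T R)
    (I : nat -> T -> int * int)
    (hI : iid_steps P lambda1 lambda2 mu1 mu2 I)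
    (x : R * R) (hx1 : 0 <= x.1) (hx2 : 0 <= x.2)
    (hx_sum : x.1 + x.2 < 1) (hx1_pos : 0 < x.1) :
  exists C7 : R, exists N : nat,
    [/\ 0 < C7, (0 < N)%N &
      forall n : nat, (N < n)%N ->
        let xn := scaled_start x n in
        `|prob_X P I n xn - prob_Y P I (T_map n xn)| / prob_X P I n xn
          = `|prob_X P I n xn - prob_Xbar P I n xn| / prob_X P I n xn
        /\ `|prob_X P I n xn - prob_Xbar P I n xn| / prob_X P I n xn
          < expR (- C7 * n%:R)].
Proof.
have rE : lambda1 + lambda2 = r * (mu1 + mu2).
  by rewrite hr divfK// gt_eqF// addr_gt0.
have l1E : lambda1 = rho1 * mu1 by rewrite hrho1 divfK// gt_eqF.
have l2E : lambda2 = rho2 * mu2 by rewrite hrho2 divfK// gt_eqF.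
have r_gt0 : 0 < r by rewrite hr divr_gt0// addr_gt0.
(* [r] is a weighted mean of [rho1] and [rho2]; equality with either would force all three to
   coincide, so both inequalities are strict. *)
have rho_mu : (rho1 - r) * mu1 = (r - rho2) * mu2.
  by move: rE; rewrite l1E l2E; lra.
have r_neq1 : r != rho1.
  apply/eqP => rE1; apply: hrho_neq; move: rho_mu.
  rewrite -rE1 subrr mul0r => /esym/eqP; rewrite mulf_eq0 (gt_eqF hmu2) orbF.
  by rewrite subr_eq0 => /eqP.
have r_neq2 : rho2 != r.
  apply/eqP => rE2; apply: hrho_neq; move: rho_mu.
  rewrite rE2 subrr mul0r => /eqP; rewrite mulf_eq0 (gt_eqF hmu1) orbF.
  by rewrite subr_eq0 => /eqP.
have r_lt : r < rho1 by rewrite lt_neqAle r_neq1.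
have l2_lt : lambda2 < r * mu2 by rewrite l2E ltr_pM2r// lt_neqAle r_neq2.
have [L L0 start] := scaled_start_bound hx1_pos hx2 hx_sum.
have [A [q [A0 q01 ratio]]] := prob_ratio_le hlambda1 hlambda2 hmu1 hmu2 hsum hI
  r_gt0 r_lt hrho1_lt1 l1E rE l2_lt L0.
have [c [N [c0 decay]]] := geometric_lt_expR A0 q01 L0.
exists c, (N + L)%N; split; rewrite ?addn_gt0 ?L0 ?orbT// => n nNL /=.
rewrite prob_YE; split=> //.
have Ln : (L <= n)%N by apply: leq_trans (ltnW nNL); rewrite leq_addl.
have [m [xm nLm mn Tx]] := start n Ln.
have n0 : (0 < n)%N by exact: leq_trans Ln.
have [_ bound] := ratio n m _ n0 Tx xm mn nLm.
apply: le_lt_trans bound _; apply: decay => //.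
by apply: leq_ltn_trans nNL; rewrite leq_addr.
Qed.
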